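(* Let $\Bbbk$ be an algebraically closed field of characteristic zero, $\xi\in\Bbbk$ a primitive eighth root of unity, $q:=\xi^2$, $\sqrt2:=\frac{2\xi}{1+\xi^2}$, and let $\mathcal{A}$ be the Kac–Paljutkin Hopf algebra over $\Bbbk$. Put $s:=\frac{1-q}{2}x+\frac{1+q}{2}gx$ and $\bar s:=\frac{1+q}{2}x+\frac{1-q}{2}gx$. The linear map $\psi:\mathcal{A}\to\mathcal{A}^*$ defined in the context is an isomorphism of Hopf algebras. The partial coactions of $\mathcal{A}$ on $\Bbbk$ are exactly the maps $\Bbbk\to\Bbbk\otimes\mathcal{A}$, $1\mapsto 1\otimes e$, where $e$ is one of the following eight elements, and under $\psi$ they correspond to the partial actions of $\mathcal{A}$ on $\Bbbk$ as follows: (1) $e=1$, $\psi(e)=\varepsilon$; (2) $e=\frac{1+g}{2}$, $\psi(e)=\lambda_{-q}$; (3) $e=\frac{1+h}{2}$, $\psi(e)=\lambda_q$; (4) $e=\frac{1+gh}{2}$, $\psi(e)=\lambda^0_{\{1,g,h,gh\}}$; (5) $e=\frac{1+g+h+gh}{4}$, $\psi(e)=\lambda^0_{\{1,gh\}}$; (6) $e=\frac{1+gh+s+ghs}{4}$, $\psi(e)=\lambda^0_{\{1,h\}}$; (7) $e=\frac{1+gh+\bar s+gh\bar s}{4}$, $\psi(e)=\lambda^0_{\{1,g\}}$; (8) $e=\frac{1+g+h+gh+x+gx+hx+ghx}{8}$, $\psi(e)=\lambda^0_{\{1\}}$.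
   Context: A (right) partial coaction of a Hopf algebra $H$ on an algebra $A$ is a linear map $\rho:A\to A\otimes H$ such that for all $a,b\in A$: (i) $(A\otimes\varepsilon)\rho(a)=a$; (ii) $\rho(ab)=\rho(a)\rho(b)$; (iii) $(\rho\otimes H)\rho(a)=(\rho(1_A)\otimes 1_H)\,(A\otimes\Delta)\rho(a)$. Here it is used with $A=\Bbbk$. A partial action of $H$ on $\Bbbk$ is a linear map $\lambda:H\to\Bbbk$ with $\lambda(1_H)=1$ and $\lambda(u)\lambda(v)=\lambda(u_1)\lambda(u_2v)$ for all $u,v\in H$. The Kac–Paljutkin algebra $\mathcal{A}$ is the $8$-dimensional Hopf algebra generated as an algebra by $g,h,x$ with relations $g^2=h^2=1$, $x^2=\tfrac12(1+g+h-gh)$, $hg=gh$, $xh=gx$, $xg=hx$; it has linear basis $\mathcal{B}_{\mathcal{A}}=\{1,g,h,gh,x,gx,hx,ghx\}$. Its coproduct is determined by $g,h$ being grouplike and $\Delta(x)=\tfrac12(x\otimes x+x\otimes gx+hx\otimes x-hx\otimes gx)$; $\varepsilon(k)=1$ for all $k\in\mathcal{B}_{\mathcal{A}}$; $S(g)=g$, $S(h)=h$, $S(x)=x$. For a subgroup $N$ of $G(\mathcal{A})=\{1,g,h,gh\}$, $\lambda_N^0:\mathcal{A}\to\Bbbk$ is the linear map with $\lambda_N^0(t)=1$ if $t\in N$ and $0$ if $t\in\mathcal{B}_{\mathcal{A}}\setminus N$. For $\zeta\in\{q,-q\}$, $\lambda_\zeta:\mathcal{A}\to\Bbbk$ is the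 linear map with $\lambda_\zeta(1)=\lambda_\zeta(gh)=1$, $\lambda_\zeta(g)=\lambda_\zeta(h)=0$, $\lambda_\zeta(x)=\lambda_\zeta(ghx)=\tfrac{1+\zeta}{2}$, $\lambda_\zeta(gx)=\lambda_\zeta(hx)=\tfrac{1-\zeta}{2}$. With $\{1^*,g^*,h^*,gh^*,x^*,gx^*,hx^*,ghx^*\}$ the basis of $\mathcal{A}^*$ dual to $\mathcal{B}_{\mathcal{A}}$, the linear map $\psi$ is given by $1\mapsto 1^*+g^*+h^*+gh^*+x^*+gx^*+hx^*+ghx^*$, $g\mapsto 1^*-g^*-h^*+gh^*-qx^*+q\,gx^*+q\,hx^*-q\,ghx^*$, $h\mapsto 1^*-g^*-h^*+gh^*+qx^*-q\,gx^*-q\,hx^*+q\,ghx^*$, $gh\mapsto 1^*+g^*+h^*+gh^*-x^*-gx^*-hx^*-ghx^*$, $x\mapsto 1^*-qg^*+qh^*-gh^*+\sqrt2\,x^*-\sqrt2\,ghx^*$, $gx\mapsto 1^*+qg^*-qh^*-gh^*+q\sqrt2\,gx^*-q\sqrt2\,hx^*$, $hx\mapsto 1^*+qg^*-qh^*-gh^*-q\sqrt2\,gx^*+q\sqrt2\,hx^*$, $ghx\mapsto 1^*-qg^*+qh^*-gh^*-\sqrt2\,x^*+\sqrt2\,ghx^*$. *)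

(* Defs.v *)
(* Every algebra here is finite-dimensional, so that the dual of a Hopf       *)
(* algebra is again one.                                                      *)
From HB Require Import structures.
From mathcomp Require Import all_boot all_algebra falgebra.

Set Implicit Arguments.
Unset Strict Implicit.
Unset Printing Implicit Defensive.

Import GRing.Theory VectorInternalTheory.

Local Open Scope ring_scope.

Reserved Notation "U \ox V" (at level 40, left associativity).

(* The coordinate basis that v2r fixes on every vectType. *)
Definition vunit (K : fieldType) (V : vectType K) (i : 'I_(dim V)) : V :=
  r2v (delta_mx 0 i).

(* A tensor is its matrix of coefficients T i j in the basis                  *)
(* vunit i \ox vunit j; tens_liftE and tens_ind give the universal property,  *)
(* after which the choice of basis is irrelevant. The alias hides the matrix  *)
(* product of the square case.                                                *)
Definition tens (K : fieldType) (U V : vectType K) : Type :=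
  'M[K]_(dim U, dim V).
HB.instance Definition _ (K : fieldType) (U V : vectType K) :=
  Vector.copy (tens U V) 'M[K]_(dim U, dim V).

Definition ptens (K : fieldType) (U V : vectType K) (u : U) (v : V) :
  tens U V := (v2r u)^T *m v2r v.
Notation "u \ox v" := (ptens u v) : ring_scope.

(* The linear map on U \ox V induced by f; only meant for bilinear f. *)
Definition tens_lift (K : fieldType) (U V W : vectType K) (f : U -> V -> W)
    (T : tens U V) : W :=
  \sum_i \sum_j T i j *: f (vunit i) (vunit j).

Definition bilin (K : fieldType) (U V W : vectType K) (f : U -> V -> W) :=
  (forall v, linear (f^~ v)) /\ (forall u, linear (f u)).

Section TensorTheory.
Variable K : fieldType.

Lemma vunit_sum (V : vectType K) (v : V) : v = \sum_i v2r v 0 i *: vunit i.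
Proof.
rewrite -{1}[v]v2rK [v2r v in LHS]row_sum_delta linear_sum /=.
by apply: eq_bigr => i _; rewrite linearZ.
Qed.

Lemma tens_lift_linear (U V W : vectType K) (f : U -> V -> W) :
  linear (tens_lift f).
Proof.
move=> a S T; rewrite /tens_lift scaler_sumr -big_split; apply: eq_bigr => i _.
rewrite scaler_sumr -big_split; apply: eq_bigr => j _ /=.
by rewrite !mxE scalerDl scalerA.
Qed.
HB.instance Definition _ (U V W : vectType K) (f : U -> V -> W) :=
  GRing.isLinear.Build K (tens U V) W _ (tens_lift f) (tens_lift_linear f).

Lemma linear_sumP (V W : vectType K) (f : V -> W) : linear f ->
  forall I (r : seq I) (c : I -> K) (v : I -> V),
  f (\sum_(i <- r) c i *: v i) = \sum_(i <- r) c i *: f (v i).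
Proof.
move=> fL I r c v; have f0 : f 0 = 0.
  by have := fL (-1) 0 0; rewrite scaler0 addr0 scaleN1r addNr.
elim: r => [|i r IHr]; first by rewrite !big_nil.
by rewrite !big_cons fL IHr.
Qed.

Lemma tens_liftE (U V W : vectType K) (f : U -> V -> W) (u : U) (v : V) :
  bilin f -> tens_lift f (u \ox v) = f u v.
Proof.
case=> fl fr; rewrite [u in RHS]vunit_sum (linear_sumP (fl v)).
apply: eq_bigr => i _; rewrite [v in RHS]vunit_sum (linear_sumP (fr _)).
rewrite scaler_sumr; apply: eq_bigr => j _.
by rewrite scalerA !mxE big_ord1 !mxE.
Qed.

Lemma tens_lift_comp (U V W W' : vectType K) (f : U -> V -> W) (g : W -> W')
    (T : tens U V) :
  linear g -> g (tens_lift f T) = tens_lift (fun u v => g (f u v)) T.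
Proof.
move=> gL; have -> : tens_lift f T =
    \sum_i 1 *: \sum_j T i j *: f (vunit i) (vunit j).
  by apply: eq_bigr => i _; rewrite scale1r.
rewrite (linear_sumP gL); apply: eq_bigr => i _.
by rewrite scale1r (linear_sumP gL).
Qed.

Lemma eq_tens_lift (U V W : vectType K) (f g : U -> V -> W) (T : tens U V) :
  f =2 g -> tens_lift f T = tens_lift g T.
Proof. by move=> fg; do 2!apply: eq_bigr => ? _; rewrite fg. Qed.

Lemma tens_lift_fun (U V W : vectType K) k (f g : U -> V -> W) (T : tens U V) :
  tens_lift (fun u v => k *: f u v + g u v) T =
  k *: tens_lift f T + tens_lift g T.
Proof.
rewrite /tens_lift scaler_sumr -big_split; apply: eq_bigr => i _.
rewrite scaler_sumr -big_split; apply: eq_bigr => j _ /=.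
by rewrite scalerDr !scalerA mulrC.
Qed.

Lemma tens_lift_exchange (U V U' V' W : vectType K)
    (f : U -> V -> U' -> V' -> W) (S : tens U V) (T : tens U' V') :
  tens_lift (fun u v => tens_lift (f u v) T) S =
  tens_lift (fun u' v' => tens_lift (fun u v => f u v u' v') S) T.
Proof.
rewrite [RHS]/tens_lift; transitivity (\sum_i \sum_j \sum_k \sum_l
    (S i j * T k l) *: f (vunit i) (vunit j) (vunit k) (vunit l)).
  do 2!apply: eq_bigr => ? _; rewrite scaler_sumr; apply: eq_bigr => ? _.
  by rewrite scaler_sumr; apply: eq_bigr => ? _; rewrite scalerA.
rewrite pair_big_dep exchange_big /=; apply: eq_bigr => k _.
rewrite exchange_big /=; apply: eq_bigr => l _.
rewrite -(pair_big_dep xpredT (fun _ => xpredT) (fun i j =>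
  (S i j * T k l) *: f (vunit i) (vunit j) (vunit k) (vunit l))) /=.
rewrite scaler_sumr; apply: eq_bigr => i _.
by rewrite scaler_sumr; apply: eq_bigr => j _; rewrite scalerA mulrC.
Qed.

Lemma ptens_bilin (U V : vectType K) : bilin (@ptens K U V).
Proof.
split=> [v a u u'|u a v v']; rewrite /ptens.
  by rewrite linearP /= linearP /= mulmxDl -scalemxAl.
by rewrite linearP /= mulmxDr -scalemxAr.
Qed.

Lemma tens_sum (U V : vectType K) (T : tens U V) :
  T = \sum_i \sum_j T i j *: (vunit i \ox vunit j).
Proof.
rewrite {1}[T]matrix_sum_delta; apply: eq_bigr => i _; apply: eq_bigr => j _.
by rewrite /ptens !r2vK trmx_delta mul_delta_mx.
Qed.

Lemma tens_ind (U V : vectType K) (P : tens U V -> Prop) :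
    (forall u v, P (u \ox v)) ->
    (forall a S T, P S -> P T -> P (a *: S + T)) ->
  forall T, P T.
Proof.
move=> Pp PD T; have P0 : P 0.
  by have := PD (-1) _ _ (Pp 0 0) (Pp 0 0); rewrite scaleN1r addNr.
rewrite (tens_sum T); elim/big_ind: _ => // [S S' PS PS'|i _].
  by rewrite -[S]scale1r; apply: PD.
elim/big_ind: _ => // [S S' PS PS'|j _].
  by rewrite -[S]scale1r; apply: PD.
by rewrite -[_ *: _]addr0; apply: PD.
Qed.
End TensorTheory.


Section TensorAlgebra.
Variables (K : fieldType) (A B : falgType K).
Implicit Types S T : tens A B.

(* (a \ox b) * (c \ox d) = (a * c) \ox (b * d) *)
Definition tens_mul S T : tens A B :=
  tens_lift (fun a b => tens_lift (fun c d => (a * c) \ox (b * d)) T) S.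

Lemma tens_mul_bilin_r a b : bilin (fun (c : A) (d : B) => (a * c) \ox (b * d)).
Proof.
have [pl pr] := @ptens_bilin _ A B.
by split=> [d k c c'|c k d d'] /=; rewrite mulrDr -scalerAr ?pl ?pr.
Qed.

Lemma tens_mul_bilin_l T : bilin (fun (a : A) (b : B) =>
  tens_lift (fun (c : A) (d : B) => (a * c) \ox (b * d)) T).
Proof.
have [pl pr] := @ptens_bilin _ A B.
have fb := tens_mul_bilin_r.
have ac k l (x y z t : tens A B) :
    l *: (k *: x + y) + (k *: z + t) = k *: (l *: x + z) + (l *: y + t).
  rewrite !scalerDr !scalerA [l * k]mulrC -!addrA.
  by congr (_ + _); rewrite addrCA.
split=> [b k a a'|a k b b'] /=; elim/tens_ind: T => [c d|l S T IHS IHT].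
- by rewrite !tens_liftE // mulrDl -scalerAl pl.
- by rewrite !tens_lift_linear IHS IHT ac.
- by rewrite !tens_liftE // mulrDl -scalerAl pr.
- by rewrite !tens_lift_linear IHS IHT ac.
Qed.

Lemma tens_mulE a b c d :
  tens_mul (a \ox b) (c \ox d) = (a * c) \ox (b * d).
Proof.
rewrite /tens_mul tens_liftE; last exact: tens_mul_bilin_l.
by rewrite tens_liftE //; apply: tens_mul_bilin_r.
Qed.

Lemma tens_mulPl k S S' T :
  tens_mul (k *: S + S') T = k *: tens_mul S T + tens_mul S' T.
Proof. exact: linearP. Qed.

Lemma tens_mulPr k S T T' :
  tens_mul S (k *: T + T') = k *: tens_mul S T + tens_mul S T'.
Proof.
elim/tens_ind: S => [a b|l S S' IH IH']; last first.
  rewrite !tens_mulPl IH IH' !scalerDr !scalerA [l * k]mulrC -!addrA.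
  by congr (_ + _); rewrite addrCA.
by rewrite /tens_mul !tens_liftE ?linearP //; apply: tens_mul_bilin_l.
Qed.

Fact tens_mulA : associative tens_mul.
Proof.
move=> R S T; elim/tens_ind: R => [a b|k R R' IH IH']; last first.
  by rewrite !tens_mulPl IH IH'.
elim/tens_ind: S => [c d|k S S' IH IH']; last first.
  by rewrite !(tens_mulPl, tens_mulPr) IH IH'.
elim/tens_ind: T => [e f|k T T' IH IH']; last by rewrite !tens_mulPr IH IH'.
by rewrite !tens_mulE !mulrA.
Qed.

Fact tens_mul1 : left_id (1 \ox 1) tens_mul.
Proof.
elim/tens_ind=> [a b|k T T' IH IH']; last by rewrite tens_mulPr IH IH'.
by rewrite tens_mulE !mul1r.
Qed.

Fact tens_mulr1 : right_id (1 \ox 1) tens_mul.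
Proof.
elim/tens_ind=> [a b|k T T' IH IH']; last by rewrite tens_mulPl IH IH'.
by rewrite tens_mulE !mulr1.
Qed.

Fact tens_mulDl : left_distributive tens_mul +%R.
Proof. by move=> S S' T; rewrite -[S]scale1r tens_mulPl !scale1r. Qed.

Fact tens_mulDr : right_distributive tens_mul +%R.
Proof. by move=> S T T'; rewrite -[T]scale1r tens_mulPr !scale1r. Qed.

Fact tens_one_neq0 : 1 \ox 1 != 0 :> tens A B.
Proof.
have nz (V : falgType K) : exists i, v2r (1 : V) 0 i != 0.
  by apply/rV0Pn; rewrite -(linear0 v2r) (inj_eq (@v2r_inj _ _)) oner_neq0.
have [[i nzi] [j nzj]] := (nz A, nz B).
apply/eqP=> /matrixP/(_ i j)/eqP; rewrite !mxE big_ord1 !mxE mulf_eq0.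
by rewrite (negPf nzi) (negPf nzj).
Qed.

HB.instance Definition _ := GRing.Zmodule_isNzRing.Build (tens A B)
  tens_mulA tens_mul1 tens_mulr1 tens_mulDl tens_mulDr tens_one_neq0.

Fact tens_scaleAl k S T : k *: (S * T) = (k *: S) * T.
Proof.
have := tens_mulPl k S 0 T.
by rewrite -[tens_mul 0 T]/(0 * T) mul0r !addr0 => <-.
Qed.
HB.instance Definition _ :=
  GRing.Lmodule_isLalgebra.Build K (tens A B) tens_scaleAl.

Fact tens_scaleAr k S T : k *: (S * T) = S * (k *: T).
Proof.
have := tens_mulPr k S T 0.
by rewrite -[tens_mul S 0]/(S * 0) mulr0 !addr0 => <-.
Qed.
HB.instance Definition _ :=
  GRing.Lalgebra_isAlgebra.Build K (tens A B) tens_scaleAr.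

HB.instance Definition _ := Algebra_isFalgebra.Build K (tens A B).

Lemma tensM a b c d :
  (a \ox b) * (c \ox d) = (a * c) \ox (b * d) :> tens A B.
Proof. exact: tens_mulE. Qed.
End TensorAlgebra.

Definition tens_map (K : fieldType) (U V U' V' : vectType K)
    (f : U -> U') (g : V -> V') : tens U V -> tens U' V' :=
  tens_lift (fun u v => f u \ox g v).

(* u \ox (v \ox w) |-> (u \ox v) \ox w *)
Definition tens_assoc (K : fieldType) (U V W : vectType K) :
    tens U (tens V W) -> tens (tens U V) W :=
  tens_lift (fun u => tens_lift (fun v w => (u \ox v) \ox w)).

HB.mixin Record isHopf (K : fieldType) H of Falgebra K H := {
  coprod : {lrmorphism H -> tens H H};
  counit : {lrmorphism H -> K^o};
  antipode : {linear H -> H};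
  coprodA : forall u,
    tens_map coprod idfun (coprod u) =
    tens_assoc (tens_map idfun coprod (coprod u));
  counitl : forall u,
    tens_lift (fun a b => (counit a : K) *: b) (coprod u) = u;
  counitr : forall u,
    tens_lift (fun a b => (counit b : K) *: a) (coprod u) = u;
  antipodel : forall u,
    tens_lift (fun a b => antipode a * b) (coprod u) = (counit u : K)%:A;
  antipoder : forall u,
    tens_lift (fun a b => a * antipode b) (coprod u) = (counit u : K)%:A
}.

#[short(type="hopfType")]
HB.structure Definition Hopf (K : fieldType) :=
  {H of isHopf K H & Falgebra K H}.

Section TensMapTheory.
Variable K : fieldType.

Lemma tens_lift_map (U V U' V' W : vectType K) (f : U -> U') (g : V -> V')
    (F : U' -> V' -> W) (T : tens U V) :
  bilin F ->
  tens_lift F (tens_map f g T) = tens_lift (fun u v => F (f u) (g v)) T.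
Proof.
move=> FB; rewrite tens_lift_comp; last exact: tens_lift_linear.
by apply: eq_tens_lift => u v; rewrite tens_liftE.
Qed.

Lemma tens_assocE (U V W : vectType K) (u : U) (v : V) (w : W) :
  tens_assoc (u \ox (v \ox w)) = (u \ox v) \ox w.
Proof.
have [pl pr] := @ptens_bilin _ U V.
have [ql qr] := @ptens_bilin _ (tens U V) W.
have B x : bilin (fun (v : V) (w : W) => (x \ox v) \ox w : tens (tens U V) W).
  by split=> [z k y y'|y k z z']; rewrite ?pr ?ql ?qr.
rewrite /tens_assoc tens_liftE ?tens_liftE //; split=> [T k x x'|x].
  elim/tens_ind: T => [y z|l S T IHS IHT].
    by rewrite !tens_liftE // pl ql.
  rewrite !tens_lift_linear IHS IHT !scalerDr !scalerA [l * k]mulrC -!addrA.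
  by congr (_ + _); rewrite addrCA.
exact: tens_lift_linear.
Qed.

Lemma tens_assoc_linear (U V W : vectType K) : linear (@tens_assoc K U V W).
Proof. exact: tens_lift_linear. Qed.
End TensMapTheory.


Definition dual (K : fieldType) (V : vectType K) : Type := 'Hom(V, K^o).
HB.instance Definition _ (K : fieldType) (V : vectType K) :=
  Vector.copy (dual V) 'Hom(V, K^o).

(* The i-th functional of the basis dual to B. *)
Definition dvec (K : fieldType) (V : vectType K) n (B : n.-tuple V)
  (i : 'I_n) : dual V := linfun (coord B i : V -> K^o).

Section DualPairing.
Variable K : fieldType.
Implicit Types V W : vectType K.

Lemma dvecE V n (B : n.-tuple V) i v : dvec B i v = coord B i v.
Proof. exact: (lfunE (coord B i : {linear V -> K^o})). Qed.

Lemma dualDE V k (f g : dual V) v : (k *: f + g) v = k *: (f v : K^o) + g v.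
Proof. by rewrite add_lfunE scale_lfunE. Qed.

(* The value on v \ox w of a tensor of functionals. *)
Definition dual_eval V W (T : tens (dual V) (dual W)) (v : V) (w : W) : K^o :=
  tens_lift (fun (f : dual V) (g : dual W) => f v * g w) T.

Lemma dual_mul_bilin V W v w :
  bilin (fun (f : dual V) (g : dual W) => f v * g w).
Proof.
split=> [g k f f'|f k g g'] /=; rewrite dualDE.
  by rewrite mulrDl scalerAl.
by rewrite mulrDr scalerAr.
Qed.

Lemma dual_evalE V W (f : dual V) (g : dual W) v w :
  dual_eval (f \ox g) v w = f v * g w.
Proof. by rewrite /dual_eval tens_liftE //; apply: dual_mul_bilin. Qed.

Lemma dual_evalP V W k (S T : tens (dual V) (dual W)) v w :
  dual_eval (k *: S + T) v w = k *: dual_eval S v w + dual_eval T v w.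
Proof. exact: tens_lift_linear. Qed.

Local Notation b V := (vbasis (fullv : {vspace V})).
Local Notation n V := (\dim (fullv : {vspace V})).

Lemma dual_basis_sum V (f : dual V) :
  f = \sum_(i < n V) f (b V)`_i *: dvec (b V) i.
Proof.
apply/lfunP=> v; rewrite sum_lfunE.
rewrite {1}(coord_vbasis (memvf v)) linear_sum; apply: eq_bigr => i _.
by rewrite linearZ scale_lfunE /= dvecE [RHS]mulrC.
Qed.

Lemma dual_eval_sum V W (T : tens (dual V) (dual W)) :
  T = \sum_(i < n V) \sum_(j < n W) dual_eval T (b V)`_i (b W)`_j *:
        (dvec (b V) i \ox dvec (b W) j).
Proof.
have [pl pr] := @ptens_bilin _ (dual V) (dual W).
elim/tens_ind: T => [f g|k S T IHS IHT].
  rewrite {1}(dual_basis_sum f) (linear_sumP (pl g)); apply: eq_bigr => i _.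
  rewrite {1}(dual_basis_sum g) (linear_sumP (pr _)) scaler_sumr.
  by apply: eq_bigr => j _; rewrite scalerA dual_evalE.
rewrite {1}IHS {1}IHT scaler_sumr -big_split; apply: eq_bigr => i _.
rewrite scaler_sumr -big_split; apply: eq_bigr => j _ /=.
by rewrite dual_evalP scalerDl scalerA.
Qed.

Lemma dual_eval_inj V W (S T : tens (dual V) (dual W)) :
  (forall v w, dual_eval S v w = dual_eval T v w) -> S = T.
Proof.
move=> eST; rewrite [S]dual_eval_sum [RHS]dual_eval_sum.
by do 2!apply: eq_bigr => ? _; rewrite eST.
Qed.

Definition dual_eval3 U V W (T : tens (tens (dual U) (dual V)) (dual W))
    (u : U) (v : V) (w : W) : K^o :=
  tens_lift (fun S (h : dual W) => dual_eval S u v * h w) T.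

Lemma dual_mul3_bilin U V W u v w : bilin
  (fun (S : tens (dual U) (dual V)) (h : dual W) => dual_eval S u v * h w).
Proof.
split=> [g k f f'|f k g g'] /=.
  by rewrite dual_evalP mulrDl scalerAl.
by rewrite dualDE mulrDr scalerAr.
Qed.

Lemma dual_eval3E U V W (S : tens (dual U) (dual V)) (h : dual W) u v w :
  dual_eval3 (S \ox h) u v w = dual_eval S u v * h w.
Proof. by rewrite /dual_eval3 tens_liftE //; apply: dual_mul3_bilin. Qed.

Lemma dual_eval3P U V W k (S T : tens (tens (dual U) (dual V)) (dual W)) u v w :
  dual_eval3 (k *: S + T) u v w = k *: dual_eval3 S u v w + dual_eval3 T u v w.
Proof. exact: tens_lift_linear. Qed.

Lemma dual_eval3_sum U V W (T : tens (tens (dual U) (dual V)) (dual W)) :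
  T = \sum_(i < n U) \sum_(j < n V) \sum_(k < n W)
        dual_eval3 T (b U)`_i (b V)`_j (b W)`_k *:
        ((dvec (b U) i \ox dvec (b V) j) \ox dvec (b W) k).
Proof.
have [pl pr] := @ptens_bilin _ (tens (dual U) (dual V)) (dual W).
elim/tens_ind: T => [S g|k S T IHS IHT].
  have sl I (r : seq I) (F : I -> tens (dual U) (dual V)) (h : dual W) :
      (\sum_(i <- r) F i) \ox h = \sum_(i <- r) (F i \ox h).
    have := linear_sumP (pl h) r (fun=> 1) F.
    under eq_bigr do rewrite scale1r.
    by under [in RHS]eq_bigr do rewrite scale1r.
  rewrite {1}(dual_eval_sum S) sl; apply: eq_bigr => i _.
  rewrite (linear_sumP (pl g)); apply: eq_bigr => j _.
  rewrite {1}(dual_basis_sum g) (linear_sumP (pr _)) scaler_sumr.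
  by apply: eq_bigr => l _; rewrite scalerA dual_eval3E.
rewrite {1}IHS {1}IHT.
do 3![rewrite scaler_sumr -big_split; apply: eq_bigr => ? _ /=].
by rewrite dual_eval3P scalerDl scalerA.
Qed.

Lemma dual_eval3_inj U V W (S T : tens (tens (dual U) (dual V)) (dual W)) :
  (forall u v w, dual_eval3 S u v w = dual_eval3 T u v w) -> S = T.
Proof.
move=> eST; rewrite [S]dual_eval3_sum [RHS]dual_eval3_sum.
by do 3!apply: eq_bigr => ? _; rewrite eST.
Qed.

Lemma dual_eval3_assoc U V W
    (T : tens (dual U) (tens (dual V) (dual W))) u v w :
  dual_eval3 (tens_assoc T) u v w =
  tens_lift (fun (f : dual U) S => f u * dual_eval S v w) T.
Proof.
have B : bilin (fun (f : dual U) (S : tens (dual V) (dual W)) =>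
    f u * dual_eval S v w).
  split=> [g k f f'|f k g g'] /=.
    by rewrite dualDE mulrDl scalerAl.
  by rewrite dual_evalP mulrDr scalerAr.
elim/tens_ind: T => [f S|k S T IHS IHT]; last first.
  by rewrite tens_assoc_linear dual_eval3P IHS IHT tens_lift_linear.
rewrite tens_liftE //; elim/tens_ind: S => [g h|k S T IHS IHT].
  by rewrite tens_assocE dual_eval3E !dual_evalE mulrA.
have [_ pr] := @ptens_bilin _ (dual U) (tens (dual V) (dual W)).
rewrite pr tens_assoc_linear dual_eval3P IHS IHT dual_evalP.
by rewrite mulrDr scalerAr.
Qed.
End DualPairing.

(* The dual Hopf algebra: convolution product, and structure maps transposed  *)
(* from those of H.                                                           *)
Section DualAlgebra.
Variables (K : fieldType) (H : hopfType K).
Implicit Types f g h : dual H.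

Definition dual_one : dual H := linfun (counit : {linear H -> K^o}).

Definition dual_mul f g : dual H :=
  linfun (tens_lift (fun u v => f u * g v : K^o) \o (coprod : H -> tens H H)).

Lemma dual_oneE u : dual_one u = counit u. Proof. exact: lfunE. Qed.

Lemma dual_mulE f g u :
  dual_mul f g u = tens_lift (fun a b => f a * g b : K^o) (coprod u).
Proof.
pose F := tens_lift (fun a b : H => f a * g b : K^o).
exact: (lfunE ((F : {linear _ -> _}) \o (coprod : {linear H -> tens H H}))).
Qed.

Lemma val_mul_bilin f g : bilin (fun a b => f a * g b : K^o).
Proof.
split=> [v k u u'|u k v v'] /=; rewrite linearP.
  by rewrite mulrDl scalerAl.
by rewrite mulrDr scalerAr.
Qed.

Fact dual_mulPl k f f' g :
  dual_mul (k *: f + f') g = k *: dual_mul f g + dual_mul f' g.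
Proof.
apply/lfunP=> u; rewrite dualDE !dual_mulE -tens_lift_fun.
by apply: eq_tens_lift => a b; rewrite dualDE mulrDl scalerAl.
Qed.

Fact dual_mulPr k f g g' :
  dual_mul f (k *: g + g') = k *: dual_mul f g + dual_mul f g'.
Proof.
apply/lfunP=> u; rewrite dualDE !dual_mulE -tens_lift_fun.
by apply: eq_tens_lift => a b; rewrite dualDE mulrDr scalerAr.
Qed.

Fact dual_mulA : associative dual_mul.
Proof.
move=> f g h; apply/lfunP=> u; rewrite !dual_mulE.
pose F (T : tens H H) c : K^o := tens_lift (fun a b => f a * g b : K^o) T * h c.
have FB : bilin F.
  split=> [c k S S'|S k c c'] /=; rewrite /F.
    by rewrite tens_lift_linear mulrDl scalerAl.
  by rewrite linearP mulrDr scalerAr.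
transitivity (tens_lift F (tens_map coprod idfun (coprod u))); last first.
  by rewrite tens_lift_map //; apply: eq_tens_lift => a b; rewrite /F dual_mulE.
pose G a (T : tens H H) : K^o := f a * tens_lift (fun b c => g b * h c : K^o) T.
have GB : bilin G.
  split=> [c k S S'|S k c c'] /=; rewrite /G.
    by rewrite linearP mulrDl scalerAl.
  by rewrite tens_lift_linear mulrDr scalerAr.
transitivity (tens_lift G (tens_map idfun coprod (coprod u))).
  by rewrite tens_lift_map //; apply: eq_tens_lift => a b; rewrite /G dual_mulE.
rewrite coprodA; move: (tens_map _ _ _) => T.
elim/tens_ind: T => [a S|k S T IHS IHT]; last first.
  by rewrite tens_assoc_linear !tens_lift_linear IHS IHT.
rewrite tens_liftE //; elim/tens_ind: S => [b c|k S T IHS IHT].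
  have fgB := val_mul_bilin.
  by rewrite tens_assocE tens_liftE // /F /G !tens_liftE // mulrA.
have [_ pr] := @ptens_bilin _ H (tens H H); case: GB => [_ Gr].
by rewrite Gr IHS IHT pr tens_assoc_linear tens_lift_linear.
Qed.

Fact dual_mul1 : left_id dual_one dual_mul.
Proof.
move=> f; apply/lfunP=> u; rewrite dual_mulE -[u in RHS]counitl.
rewrite (tens_lift_comp _ _ (linearP f)); apply: eq_tens_lift => a b.
by rewrite linearZ dual_oneE.
Qed.

Fact dual_mulr1 : right_id dual_one dual_mul.
Proof.
move=> f; apply/lfunP=> u; rewrite dual_mulE -[u in RHS]counitr.
rewrite (tens_lift_comp _ _ (linearP f)); apply: eq_tens_lift => a b.
by rewrite linearZ dual_oneE [RHS]mulrC.
Qed.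

Fact dual_mulDl : left_distributive dual_mul +%R.
Proof. by move=> f f' g; rewrite -[f]scale1r dual_mulPl !scale1r. Qed.

Fact dual_mulDr : right_distributive dual_mul +%R.
Proof. by move=> f g g'; rewrite -[g]scale1r dual_mulPr !scale1r. Qed.

Fact dual_one_neq0 : dual_one != 0.
Proof.
apply/eqP=> /lfunP/(_ 1)/eqP; rewrite dual_oneE rmorph1 zero_lfunE.
by rewrite oner_eq0.
Qed.

HB.instance Definition _ := GRing.Zmodule_isNzRing.Build (dual H)
  dual_mulA dual_mul1 dual_mulr1 dual_mulDl dual_mulDr dual_one_neq0.

Fact dual_scaleAl k f g : k *: (f * g) = (k *: f) * g.
Proof.
have := dual_mulPl k f 0 g.
by rewrite -[dual_mul 0 g]/(0 * g) mul0r !addr0 => <-.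
Qed.
HB.instance Definition _ :=
  GRing.Lmodule_isLalgebra.Build K (dual H) dual_scaleAl.

Fact dual_scaleAr k f g : k *: (f * g) = f * (k *: g).
Proof.
have := dual_mulPr k f g 0.
by rewrite -[dual_mul f 0]/(f * 0) mulr0 !addr0 => <-.
Qed.
HB.instance Definition _ :=
  GRing.Lalgebra_isAlgebra.Build K (dual H) dual_scaleAr.

HB.instance Definition _ := Algebra_isFalgebra.Build K (dual H).

Lemma dual1E u : (1 : dual H) u = counit u. Proof. exact: dual_oneE. Qed.

Lemma dualME f g u :
  (f * g : dual H) u = tens_lift (fun a b => f a * g b : K^o) (coprod u).
Proof. exact: dual_mulE. Qed.
End DualAlgebra.

Section DualHopf.
Variables (K : fieldType) (H : hopfType K).
Implicit Types f g h : dual H.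
Local Notation b := (vbasis (fullv : {vspace H})).

(* The tensor with dual_eval (dual_coprod f) u v = f (u * v). *)
Definition dual_coprod f : tens (dual H) (dual H) :=
  \sum_(i < \dim (fullv : {vspace H})) \sum_(j < \dim (fullv : {vspace H}))
    f (b`_i * b`_j) *: (dvec b i \ox dvec b j).

Definition dual_counit f : K^o := f 1.

Definition dual_antipode f : dual H := linfun (f \o (antipode : H -> H)).

Fact dual_coprod_linear : linear dual_coprod.
Proof.
move=> k f g; rewrite /dual_coprod.
do 2![rewrite scaler_sumr -big_split; apply: eq_bigr => ? _ /=].
by rewrite dualDE scalerDl scalerA.
Qed.
HB.instance Definition _ := GRing.isLinear.Build K (dual H)
  (tens (dual H) (dual H)) _ dual_coprod dual_coprod_linear.

Lemma dual_coprodE f u v : dual_eval (dual_coprod f) u v = f (u * v).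
Proof.
rewrite {2}(coord_vbasis (memvf u)) {2}(coord_vbasis (memvf v)).
rewrite mulr_suml linear_sum.
rewrite /dual_eval /dual_coprod linear_sum; apply: eq_bigr => i _.
rewrite mulr_sumr !linear_sum; apply: eq_bigr => j _.
rewrite linearZ /= -/(dual_eval _ u v) dual_evalE !dvecE.
by rewrite -scalerAl -scalerAr !linearZ /=; congr (_ *: _); apply: mulrC.
Qed.

Lemma dual_evalM (S T : tens (dual H) (dual H)) u v :
  dual_eval (S * T) u v =
  tens_lift (fun a1 a2 => tens_lift
    (fun b1 b2 => dual_eval S a1 b1 * dual_eval T a2 b2) (coprod v)) (coprod u).
Proof.
elim/tens_ind: S => [f f'|k S S' IH IH']; last first.
  rewrite mulrDl -scalerAl dual_evalP IH IH' -tens_lift_fun.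
  apply: eq_tens_lift => a1 a2; rewrite -tens_lift_fun.
  by apply: eq_tens_lift => b1 b2; rewrite dual_evalP mulrDl scalerAl.
elim/tens_ind: T => [g g'|k S S' IH IH']; last first.
  rewrite mulrDr -scalerAr dual_evalP IH IH' -tens_lift_fun.
  apply: eq_tens_lift => a1 a2; rewrite -tens_lift_fun.
  by apply: eq_tens_lift => b1 b2; rewrite dual_evalP mulrDr scalerAr.
rewrite tensM dual_evalE !dualME.
rewrite (@tens_lift_comp _ _ _ _ _ _ (fun c : K^o => c * _)); last first.
  by move=> k c c'; rewrite mulrDl scalerAl.
apply: eq_tens_lift => a1 a2.
rewrite (@tens_lift_comp _ _ _ _ _ _ (fun c : K^o => _ * c)); last first.
  by move=> k c c'; rewrite mulrDr scalerAr.
by apply: eq_tens_lift => b1 b2; rewrite !dual_evalE mulrACA.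
Qed.

Fact dual_coprod_monoid : monoid_morphism dual_coprod.
Proof.
split=> [|f g]; apply: dual_eval_inj => u v.
  by rewrite dual_coprodE dual_evalE !dual1E rmorphM.
rewrite dual_coprodE dualME rmorphM dual_evalM.
transitivity (tens_lift (fun a1 a2 => tens_lift
   (fun b1 b2 => f (a1 * b1) * g (a2 * b2) : K^o) (coprod v)) (coprod u)).
  rewrite -[_ * _]/(tens_mul (coprod u) (coprod v)) /tens_mul.
  rewrite tens_lift_comp; last exact: tens_lift_linear.
  apply: eq_tens_lift => a1 a2.
  rewrite tens_lift_comp; last exact: tens_lift_linear.
  apply: eq_tens_lift => b1 b2.
  by rewrite tens_liftE //; apply: val_mul_bilin.
apply: eq_tens_lift => a1 a2; apply: eq_tens_lift => b1 b2.
by rewrite !dual_coprodE.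
Qed.
HB.instance Definition _ := GRing.isMonoidMorphism.Build (dual H)
  (tens (dual H) (dual H)) dual_coprod dual_coprod_monoid.

Fact dual_counit_linear : linear dual_counit.
Proof. by move=> k f g; rewrite /dual_counit dualDE. Qed.
HB.instance Definition _ := GRing.isLinear.Build K (dual H)
  K^o _ dual_counit dual_counit_linear.

Fact dual_counit_monoid : monoid_morphism dual_counit.
Proof.
split=> [|f g]; rewrite /dual_counit ?dual1E ?rmorph1 //.
by rewrite dualME rmorph1 tens_liftE //; apply: val_mul_bilin.
Qed.
HB.instance Definition _ := GRing.isMonoidMorphism.Build (dual H)
  K^o dual_counit dual_counit_monoid.

Lemma dual_antipodeE f u : dual_antipode f u = f (antipode u).
Proof. exact: (lfunE ((f : {linear H -> K^o}) \o antipode)). Qed.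

Fact dual_antipode_linear : linear dual_antipode.
Proof.
by move=> k f g; apply/lfunP=> u; rewrite dualDE !dual_antipodeE dualDE.
Qed.
HB.instance Definition _ := GRing.isLinear.Build K (dual H)
  (dual H) _ dual_antipode dual_antipode_linear.

Lemma dual_ev_linear u : linear (fun f => f u : K^o).
Proof. by move=> k f g; rewrite dualDE. Qed.

Fact dual_coprodA f :
  tens_map dual_coprod idfun (dual_coprod f) =
  tens_assoc (tens_map idfun dual_coprod (dual_coprod f)).
Proof.
apply: dual_eval3_inj => u v w; rewrite dual_eval3_assoc /dual_eval3.
rewrite !tens_lift_map; first last.
- exact: dual_mul3_bilin.
- split=> [T k g g'|g k T T'] /=.
    by rewrite dualDE mulrDl scalerAl.
  by rewrite dual_evalP mulrDr scalerAr.
transitivity (f (u * v * w)).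
  rewrite -dual_coprodE; apply: eq_tens_lift => g h.
  by rewrite dual_coprodE.
rewrite -mulrA -dual_coprodE; apply: eq_tens_lift => g h.
by rewrite dual_coprodE.
Qed.

Fact dual_counitl f :
  tens_lift (fun g h => (dual_counit g : K) *: h) (dual_coprod f) = f.
Proof.
apply/lfunP=> u; rewrite (tens_lift_comp _ _ (dual_ev_linear u)).
rewrite -[u in RHS]mul1r -dual_coprodE; apply: eq_tens_lift => g h.
by rewrite scale_lfunE.
Qed.

Fact dual_counitr f :
  tens_lift (fun g h => (dual_counit h : K) *: g) (dual_coprod f) = f.
Proof.
apply/lfunP=> u; rewrite (tens_lift_comp _ _ (dual_ev_linear u)).
rewrite -[u in RHS]mulr1 -dual_coprodE; apply: eq_tens_lift => g h.
by rewrite scale_lfunE [LHS]mulrC.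
Qed.

Fact dual_antipodel f :
  tens_lift (fun g h => dual_antipode g * h) (dual_coprod f) =
  (dual_counit f : K)%:A.
Proof.
apply/lfunP=> u; rewrite (tens_lift_comp _ _ (dual_ev_linear u)).
under eq_tens_lift => g h do rewrite dualME.
rewrite tens_lift_exchange scale_lfunE dual1E.
transitivity (f (tens_lift (fun a b => antipode a * b) (coprod u))).
  rewrite (tens_lift_comp _ _ (linearP f)); apply: eq_tens_lift => a c /=.
  rewrite -dual_coprodE; apply: eq_tens_lift => g h.
  by rewrite dual_antipodeE.
by rewrite antipodel linearZ [LHS]mulrC.
Qed.

Fact dual_antipoder f :
  tens_lift (fun g h => g * dual_antipode h) (dual_coprod f) =
  (dual_counit f : K)%:A.
Proof.
apply/lfunP=> u; rewrite (tens_lift_comp _ _ (dual_ev_linear u)).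
under eq_tens_lift => g h do rewrite dualME.
rewrite tens_lift_exchange scale_lfunE dual1E.
transitivity (f (tens_lift (fun a b => a * antipode b) (coprod u))).
  rewrite (tens_lift_comp _ _ (linearP f)); apply: eq_tens_lift => a c /=.
  rewrite -dual_coprodE; apply: eq_tens_lift => g h.
  by rewrite dual_antipodeE.
by rewrite antipoder linearZ [LHS]mulrC.
Qed.

HB.instance Definition _ := isHopf.Build K (dual H)
  dual_coprodA dual_counitl dual_counitr dual_antipodel dual_antipoder.
End DualHopf.

Section PartialActions.
Variables (K : fieldType) (H : hopfType K).

Definition partial_coaction (A : falgType K) (rho : {linear A -> tens A H}) :
    Prop :=
  [/\ forall a, tens_lift (fun b u => (counit u : K) *: b) (rho a) = a,
      {morph rho : a b / a * b}
    & forall a, tens_map rho idfun (rho a) =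
        (rho 1 \ox 1) * tens_assoc (tens_map idfun coprod (rho a))].

Definition partial_action (lam : dual H) : Prop :=
  lam 1 = 1 /\
  forall u v,
    lam u * lam v = tens_lift (fun a b => lam a * lam (b * v) : K^o) (coprod u).

Definition hopf_iso (L : hopfType K) (f : H -> L) : Prop :=
  [/\ linear f /\ bijective f,
      monoid_morphism f,
      forall u, coprod (f u) = tens_map f f (coprod u),
      forall u, counit (f u) = counit u
    & forall u, antipode (f u) = f (antipode u)].
End PartialActions.

Section KacPaljutkin.
Variables (K : fieldType) (A : hopfType K) (g h x : A).

Definition kp_basis : 8.-tuple A :=
  [tuple 1; g; h; g * h; x; g * x; h * x; g * h * x].

(* The relations together with kp_basisP make A the algebra presented by g,   *)
(* h, x, and the values below determine the rest of its Hopf structure.       *)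
Record kac_paljutkin : Prop := KacPaljutkin {
  kp_gg : g ^+ 2 = 1;
  kp_hh : h ^+ 2 = 1;
  kp_xx : x ^+ 2 = 2^-1 *: (1 + g + h - g * h);
  kp_hg : h * g = g * h;
  kp_xh : x * h = g * x;
  kp_xg : x * g = h * x;
  kp_basisP : basis_of fullv kp_basis;
  kp_coprod_g : coprod g = g \ox g;
  kp_coprod_h : coprod h = h \ox h;
  kp_coprod_x : coprod x =
    2^-1 *: (x \ox x + x \ox (g * x) + (h * x) \ox x - (h * x) \ox (g * x));
  kp_counit : {in kp_basis, forall u, counit u = 1};
  kp_antipode_g : antipode g = g;
  kp_antipode_h : antipode h = h;
  kp_antipode_x : antipode x = x
}.

(* The basis dual to kp_basis, in the same order. *)
Definition kp_dual (i : nat) : dual A := dvec kp_basis (inord i).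

Definition kp_lambda0 (N : seq A) : dual A :=
  \sum_(i < 8) (kp_basis`_i \in N)%:R *: dvec kp_basis i.

Definition kp_lambda (z : K) : dual A :=
  let d1 := kp_dual 0 in let dgh := kp_dual 3 in
  let dx := kp_dual 4 in let dgx := kp_dual 5 in
  let dhx := kp_dual 6 in let dghx := kp_dual 7 in
  d1 + dgh + ((1 + z) / 2) *: (dx + dghx) + ((1 - z) / 2) *: (dgx + dhx).

Definition kp_psi_basis (q sqrt2 : K) : 8.-tuple (dual A) :=
  let d1 := kp_dual 0 in let dg := kp_dual 1 in
  let dh := kp_dual 2 in let dgh := kp_dual 3 in
  let dx := kp_dual 4 in let dgx := kp_dual 5 in
  let dhx := kp_dual 6 in let dghx := kp_dual 7 in
  [tuple
    d1 + dg + dh + dgh + dx + dgx + dhx + dghx;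
    d1 - dg - dh + dgh - q *: dx + q *: dgx + q *: dhx - q *: dghx;
    d1 - dg - dh + dgh + q *: dx - q *: dgx - q *: dhx + q *: dghx;
    d1 + dg + dh + dgh - dx - dgx - dhx - dghx;
    d1 - q *: dg + q *: dh - dgh + sqrt2 *: dx - sqrt2 *: dghx;
    d1 + q *: dg - q *: dh - dgh + (q * sqrt2) *: dgx - (q * sqrt2) *: dhx;
    d1 + q *: dg - q *: dh - dgh - (q * sqrt2) *: dgx + (q * sqrt2) *: dhx;
    d1 - q *: dg + q *: dh - dgh - sqrt2 *: dx + sqrt2 *: dghx].

Definition kp_psi (q sqrt2 : K) (a : A) : dual A :=
  \sum_(i < 8) coord kp_basis i a *: (kp_psi_basis q sqrt2)`_i.
End KacPaljutkin.

(* Main.v *)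
From HB Require Import structures.
Require Import Defs.
From mathcomp Require Import all_boot all_algebra falgebra ring.

(* A partial coaction on the field is 1 |-> 1 \ox e with counit e = 1 and     *)
(* e \ox e = (e \ox 1) * coprod e, and a partial action of H is the same      *)
(* thing for the Hopf algebra dual H. Hence the isomorphism psi matches the   *)
(* two notions and only the partial actions lam have to be classified. On the *)
(* group-likes lam is the indicator function of a subgroup N, it is invariant *)
(* under left translation by N, and in each of the five cases for N the       *)
(* equations for u in {x, gx, hx, ghx} and v group-like determine lam.        *)
(* The matrix of psi in the bases kp_basis and its dual is symmetric, so that *)
(* the compatibility of psi with coproducts follows from that with products.  *)

Set Implicit Arguments.
Unset Strict Implicit.
Unset Printing Implicit Defensive.

Import GRing.Theory.
Local Open Scope ring_scope.

(** * Bilinear maps and tensors *)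

(** Writing [rho 1] as [1 \ox e] turns the coaction axioms into [coaction_elt e]
    ([partial_coaction_scalarP]). Since [dual H] has the convolution product and the transposed
    coproduct, the same two equations for a functional say that it is a partial action
    ([partial_actionP]), and Hopf isomorphisms preserve them ([hopf_iso_coaction_elt]). That [psi]
    is such an isomorphism is read off the matrix of the pairing [psi u v]. Multiplicativity is a
    finite check for the left factors g, h, x ([kp_matrix_mul]); symmetry of the matrix transposes
    it into comultiplicativity; orthogonality of the rows gives bijectivity; and every bialgebra
    morphism respects antipodes. What remains is to solve the quadratic equations for the eight
    values of a partial action ([kp_actions_complete], [kp_actions_sound]) and to evaluate [psi] on
    the eight elements ([kp_psi_elts_values]). *)

Section Bilinear.
Variable K : fieldType.

Lemma linear_prop0 (V W : vectType K) (f : V -> W) : linear f -> f 0 = 0.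
Proof. by move=> fL; have := fL (-1) 0 0; rewrite scaler0 addr0 scaleN1r addNr. Qed.

Lemma linear_propZ (V W : vectType K) (f : V -> W) k v :
  linear f -> f (k *: v) = k *: f v.
Proof.
by move=> fL; have := fL k v 0; rewrite !addr0 (linear_prop0 fL) addr0.
Qed.

Lemma linear_tens_ext (U V W : vectType K) (f f' : tens U V -> W) :
  linear f -> linear f' -> (forall u v, f (u \ox v) = f' (u \ox v)) -> f =1 f'.
Proof.
move=> fL f'L eff'; elim/tens_ind=> [//|k S T IHS IHT].
by rewrite fL f'L IHS IHT.
Qed.

Lemma tens_map_linear (U V U' V' : vectType K) (f : U -> U') (g : V -> V') :
  linear (tens_map f g).
Proof. exact: tens_lift_linear. Qed.

Lemma ptensZl (U V : vectType K) k (u : U) (v : V) :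
  (k *: u) \ox v = k *: (u \ox v).
Proof. by have [pl _] := @ptens_bilin K U V; apply: (linear_propZ _ _ (pl v)). Qed.

Lemma ptensZr (U V : vectType K) k (u : U) (v : V) :
  u \ox (k *: v) = k *: (u \ox v).
Proof. by have [_ pr] := @ptens_bilin K U V; apply: linear_propZ. Qed.

Lemma ptensDr (U V : vectType K) (u : U) (v v' : V) :
  u \ox (v + v') = u \ox v + u \ox v'.
Proof. by have [_ pr] := @ptens_bilin K U V; rewrite -[v]scale1r pr !scale1r. Qed.

Lemma mul_bilin (U V : vectType K) (L : falgType K) (f : U -> L) (g : V -> L) :
  linear f -> linear g -> bilin (fun u v => f u * g v).
Proof.
move=> fL gL; split=> [v k a b|u k a b] /=.
  by rewrite fL mulrDl scalerAl.
by rewrite gL mulrDr scalerAr.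
Qed.

Lemma scale_bilin (V : vectType K) : bilin (fun (k : K^o) (v : V) => (k : K) *: v).
Proof.
split=> [v k a b|u k a b] /=; first by rewrite scalerDl scalerA.
by rewrite scalerDr !scalerA mulrC.
Qed.

Lemma tens_mapE (U V U' V' : vectType K) (f : U -> U') (g : V -> V') u v :
  linear f -> linear g -> tens_map f g (u \ox v) = f u \ox g v.
Proof.
move=> fL gL; have [pl pr] := @ptens_bilin _ U' V'.
by rewrite /tens_map tens_liftE //; split=> [w k a b|w k a b] /=;
  rewrite ?fL ?gL ?pl ?pr.
Qed.

Lemma linear_comp (U V W : vectType K) (f : V -> W) (f' : U -> V) :
  linear f -> linear f' -> linear (f \o f').
Proof. by move=> fL f'L k a b /=; rewrite f'L fL. Qed.

Lemma tens_map_comp (U V U' V' U'' V'' : vectType K) (f : U -> U')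
    (g : V -> V') (f' : U' -> U'') (g' : V' -> V'') (T : tens U V) :
  linear f -> linear g -> linear f' -> linear g' ->
  tens_map f' g' (tens_map f g T) = tens_map (f' \o f) (g' \o g) T.
Proof.
move=> fL gL f'L g'L.
apply: (@linear_tens_ext _ _ _ (tens_map f' g' \o tens_map f g)).
- by apply: linear_comp; apply: tens_map_linear.
- exact: tens_map_linear.
by move=> u v /=; rewrite !tens_mapE //; apply: linear_comp.
Qed.

Lemma tens_map_id (U V : vectType K) (f : U -> U) (g : V -> V) (T : tens U V) :
  f =1 id -> g =1 id -> tens_map f g T = T.
Proof.
move=> fE gE; apply: (@linear_tens_ext _ _ _ (tens_map f g) id) => //.
  exact: tens_map_linear.
by move=> u v; rewrite tens_mapE ?fE ?gE // => k a b; rewrite ?fE ?gE.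
Qed.

Lemma tens_map_inj (U V U' V' : vectType K) (f : U -> U') (g : V -> V')
    (f' : U' -> U) (g' : V' -> V) :
  linear f -> linear g -> linear f' -> linear g' ->
  cancel f f' -> cancel g g' -> injective (tens_map f g).
Proof.
move=> fL gL f'L g'L fK gK; apply: (can_inj (g := tens_map f' g')) => T.
by rewrite tens_map_comp // tens_map_id.
Qed.

Lemma tens_scalarE (V : vectType K) (T : tens K^o V) :
  T = (1 : K^o) \ox tens_lift (fun (k : K^o) v => (k : K) *: v) T.
Proof.
pose f T := (1 : K^o) \ox tens_lift (fun (k : K^o) (v : V) => (k : K) *: v) T.
apply: (@linear_tens_ext _ _ _ id f) => //.
  by move=> k a b; rewrite /f tens_lift_linear ptensDr ptensZr.
move=> k v; rewrite /f tens_liftE; last exact: scale_bilin.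
by rewrite ptensZr -ptensZl /GRing.scale /= mulr1.
Qed.

Lemma tens_scalarK (V : vectType K) :
  cancel (fun v : V => (1 : K^o) \ox v)
         (tens_lift (fun (k : K^o) v => (k : K) *: v)).
Proof. by move=> v; rewrite tens_liftE ?scale1r //; apply: scale_bilin. Qed.
End Bilinear.


(** * Hopf algebra morphisms and partial coactions on the field *)

Section HopfMorphism.
Variables (K : fieldType) (H L : hopfType K).

(* Both antipode \o f and f \o antipode are convolution inverses of f.        *)
Lemma bialg_morphism_antipode (f : H -> L) :
    linear f -> monoid_morphism f ->
    (forall u, coprod (f u) = tens_map f f (coprod u)) ->
    (forall u, counit (f u) = counit u) ->
  forall u, antipode (f u) = f (antipode u).
Proof.
move=> fL [f1 fM] fD fe u.
have fZ k v : f (k *: v) = k *: f v by apply: linear_propZ.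
pose Sf a := antipode (f a); pose fS a := f (antipode a).
have SfL : linear Sf by move=> k a b; rewrite /Sf fL linearP.
have fSL : linear fS by move=> k a b; rewrite /fS linearP fL.
pose P := tens_lift (fun a b => Sf a * f b).
pose Q := tens_lift (fun a b => f a * fS b).
have Pcoprod a : P (coprod a) = (counit a : K)%:A.
  by rewrite -fe -antipodel fD tens_lift_map //; apply: mul_bilin => //; apply: linearP.
have Qcoprod a : Q (coprod a) = (counit a : K)%:A.
  rewrite -f1 -fZ -antipoder (tens_lift_comp _ _ fL).
  by apply: eq_tens_lift => b c; rewrite fM.
have PL : linear P by apply: tens_lift_linear.
have QL : linear Q by apply: tens_lift_linear.
have PB : bilin (fun T c => P T * fS c) by apply: mul_bilin.
have QB : bilin (fun a T => Sf a * Q T) by apply: mul_bilin.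
have assocPQ T : tens_lift (fun T c => P T * fS c) (tens_assoc T) =
                 tens_lift (fun a T => Sf a * Q T) T.
  elim/tens_ind: T => [a T|k T T' IH IH']; last first.
    by rewrite tens_assoc_linear !tens_lift_linear IH IH'.
  rewrite [RHS]tens_liftE //; elim/tens_ind: T => [b c|k T T' IH IH'].
    rewrite tens_assocE tens_liftE // /P /Q !tens_liftE ?mulrA //.
      exact: mul_bilin.
    exact: mul_bilin.
  by rewrite ptensDr ptensZr tens_assoc_linear tens_lift_linear IH IH' QL mulrDr scalerAr.
(* The common value is Sf(u1) f(u2) fS(u3): bracketed to the right it collapses to [Sf u], bracketed
   to the left to [fS u]. *)
transitivity (tens_lift (fun a T => Sf a * Q T)
    (tens_map idfun coprod (coprod u))).
  rewrite -[u in LHS]counitr -/(Sf _) (tens_lift_comp _ _ SfL) tens_lift_map //.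
  apply: eq_tens_lift => a b; rewrite Qcoprod -scalerAr mulr1.
  by rewrite /Sf fZ linearZ.
rewrite -assocPQ -coprodA -[u in RHS]counitl -/(fS _) (tens_lift_comp _ _ fSL).
rewrite tens_lift_map //; apply: eq_tens_lift => a b.
by rewrite Pcoprod -scalerAl mul1r /fS linearZ fZ.
Qed.

End HopfMorphism.

(** * Partial coactions on the field and partial actions as solutions of one equation *)

Section CoactionElement.
Variable K : fieldType.

(* The form taken by e when 1 |-> 1 \ox e is a partial coaction; idempotence  *)
(* of e follows by applying the counit to the second leg.                     *)
Definition coaction_elt (H : hopfType K) (e : H) : Prop :=
  counit e = 1 /\ e \ox e = (e \ox 1) * coprod e.

Lemma coaction_elt_idem (H : hopfType K) (e : H) : coaction_elt e -> e * e = e.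
Proof.
case=> ee1 eeE; pose C := tens_lift (fun a b : H => (counit b : K) *: a).
have B : bilin (fun a b : H => (counit b : K) *: a).
  split=> [v k a b|u k a b] /=; first by rewrite scalerDr !scalerA mulrC.
  by rewrite linearP scalerDl scalerA.
have CM a T : C ((a \ox 1) * T) = a * C T.
  elim/tens_ind: T => [b c|k T T' IH IH'].
    by rewrite tensM /C !tens_liftE // mul1r scalerAr.
  by rewrite mulrDr -scalerAr /C !tens_lift_linear -!/(C _) IH IH' mulrDr scalerAr.
have := congr1 C eeE; rewrite CM {2}/C counitr => <-.
by rewrite /C tens_liftE // ee1 scale1r.
Qed.

(** Under the identification of K ⊗ H with H the three axioms become counit e = 1, e e = e and e ⊗ e
    = (e ⊗ 1) Δ(e); the second follows from the other two by [coaction_elt_idem]. *)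
Lemma partial_coaction_scalarP (H : hopfType K)
    (rho : {linear K^o -> tens K^o H}) :
  partial_coaction rho <-> exists2 e, coaction_elt e & rho 1 = 1 \ox e.
Proof.
(* Both sides of the third axiom lie in the image of [J], whose injectivity lets it be cancelled. *)
pose i (u : H) := (1 : K^o) \ox u; pose J := tens_map i (@idfun H).
have iL : linear i by move=> k a b; rewrite /i ptensDr ptensZr.
have idL : linear (@idfun H) by [].
have iJ : injective J.
  apply: (@tens_map_inj _ _ _ _ _ i idfun
            (tens_lift (fun (k : K^o) v => (k : K) *: v)) idfun) => //.
    exact: tens_lift_linear.
  exact: tens_scalarK.
have assocJ T : tens_assoc ((1 : K^o) \ox T) = J T.
  elim/tens_ind: T => [u v|k S T IHS IHT].
    by rewrite tens_assocE /J tens_mapE.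
  by rewrite ptensDr ptensZr tens_assoc_linear IHS IHT /J tens_map_linear.
have JM e T : (i e \ox 1) * J T = J ((e \ox 1) * T).
  elim/tens_ind: T => [b c|k T T' IH IH'].
    by rewrite tensM /J !tens_mapE // tensM /i tensM !mul1r.
  rewrite mulrDr -scalerAr /J !tens_map_linear -!/(J _) -IH -IH'.
  by rewrite mulrDr scalerAr.
have rhoE e (a : K^o) : rho 1 = i e -> rho a = (a : K) *: i e.
  by move=> <-; rewrite -linearZ /GRing.scale /= mulr1.
have third e : rho 1 = i e ->
  tens_map rho idfun (rho 1) = J (e \ox e) /\
  (rho 1 \ox 1) * tens_assoc (tens_map idfun coprod (rho 1)) =
    J ((e \ox 1) * coprod e).
  move=> r1; rewrite r1; split.
    by rewrite /J /i !tens_mapE //; [rewrite r1 | apply: linearP].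
  rewrite -JM -assocJ tens_mapE //; apply: linearP.
have coB : bilin (fun (b : K^o) (u : H) => (counit u : K) *: b).
  split=> [v k a b|u k a b] /=; first by rewrite scalerDr !scalerA mulrC.
  by rewrite linearP scalerDl scalerA.
split=> [[rhoe rhoM rhoA]|[e ec r1]].
  have r1 := tens_scalarE (rho 1); set e := tens_lift _ _ in r1.
  exists e => //; split.
    have := rhoe 1; rewrite r1 tens_liftE // => <-.
    by rewrite /GRing.scale /= mulr1.
  by apply: iJ; have [<- <-] := third e r1; apply: rhoA.
have ee := coaction_elt_idem ec; case: ec => e1 eE.
split=> [a|a b|a].
- rewrite (rhoE _ _ r1) linearZ /= tens_liftE // e1 scale1r.
  by rewrite /GRing.scale /= mulr1.
- rewrite !(rhoE _ _ r1) -scalerAl -scalerAr scalerA /i tensM ee mulr1.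
  by [].
have [t3 t3'] := third e r1; have raE : rho a = (a : K) *: rho 1.
  by rewrite (rhoE _ _ r1) r1.
rewrite raE !(linear_propZ _ _ (tens_map_linear _ _)) t3 eE -t3'.
by rewrite (linear_propZ _ _ (tens_assoc_linear (W := _))) scalerAr.
Qed.

(** Evaluated at (u, v), (lam ⊗ 1) Δ(lam) is the sum of lam(u1) ε(v1) lam(u2 v2), that is of lam(u1)
    lam(u2 v). *)
Lemma partial_actionP (H : hopfType K) (lam : dual H) :
  partial_action lam <-> coaction_elt lam.
Proof.
have E u v : dual_eval ((lam \ox 1) * coprod lam) u v =
    tens_lift (fun a b => lam a * lam (b * v) : K^o) (coprod u).
  rewrite dual_evalM; apply: eq_tens_lift => a b.
  pose F w : K^o := lam a * lam (b * w).
  have FL : linear F.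
    by move=> k w w'; rewrite /F mulrDr -scalerAr linearP mulrDr scalerAr.
  rewrite -/(F v) -[v in RHS]counitl (tens_lift_comp _ _ FL).
  apply: eq_tens_lift => c d; rewrite dual_evalE dual_coprodE dual1E.
  by rewrite (linear_propZ _ _ FL) /F [RHS]mulrCA mulrA.
split=> [[l1 lM]|[l1 lM]]; split=> //.
  by apply: dual_eval_inj => u v; rewrite dual_evalE lM E.
by move=> u v; rewrite -E -lM dual_evalE.
Qed.

Lemma hopf_iso_coaction_elt (H L : hopfType K) (f : H -> L) (e : H) :
  hopf_iso f -> coaction_elt (f e) <-> coaction_elt e.
Proof.
case=> -[fL [f' fK f'K]] [f1 fM] fD fe _.
have f'L : linear f' by move=> k a b; apply: (can_inj fK); rewrite fL !f'K.
have ffI : injective (tens_map f f) by apply: (@tens_map_inj _ _ _ _ _ f f f' f').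
have tM S T : tens_map f f (S * T) = tens_map f f S * tens_map f f T.
  elim/tens_ind: S => [a b|k S S' IH IH']; last first.
    by rewrite mulrDl -scalerAl !tens_map_linear IH IH' mulrDl scalerAl.
  elim/tens_ind: T => [c d|k T T' IH IH'].
    by rewrite tensM !tens_mapE // tensM !fM.
  by rewrite mulrDr -scalerAr !tens_map_linear IH IH' mulrDr scalerAr.
rewrite /coaction_elt fe fD -[f e \ox f e]tens_mapE //.
rewrite -f1 -[f e \ox f 1]tens_mapE // -tM.
by split=> -[ee1 eE]; split=> //; [apply: ffI | rewrite eE].
Qed.

End CoactionElement.

(** * The Kac-Paljutkin algebra in coordinates *)

Section KacPaljutkinTheory.
Variables (K : fieldType) (A : hopfType K) (g h x : A).
Hypothesis kpA : kac_paljutkin g h x.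

Local Notation B := (kp_basis g h x).

Lemma kp_gMg : g * g = 1. Proof. exact: kp_gg kpA. Qed.
Lemma kp_hMh : h * h = 1. Proof. exact: kp_hh kpA. Qed.
Lemma kp_xMx : x * x = 2^-1 *: (1 + g + h - g * h). Proof. exact: kp_xx kpA. Qed.

(** A rewriting system towards the order g, h, x. Each commutation rule comes also with a trailing
    factor [w], so that it applies inside right-associated products. *)
Lemma kp_mulE :
  ((g * g = 1)%R * (forall w, g * (g * w) = w)%R *
   ((h * h = 1)%R * (forall w, h * (h * w) = w)%R) *
   ((h * g = g * h)%R * (forall w, h * (g * w) = g * (h * w))%R) *
   ((x * g = h * x)%R * (forall w, x * (g * w) = h * (x * w))%R) *
   ((x * h = g * x)%R * (forall w, x * (h * w) = g * (x * w))%R) *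
   (x * x = 2^-1 *: (1 + g + h - g * h))%R)%type.
Proof.
have [[gg hh] xx] := (kp_gMg, kp_hMh, kp_xMx).
have [[hg xh] xg] := (kp_hg kpA, kp_xh kpA, kp_xg kpA).
have ggw w : g * (g * w) = w by rewrite mulrA gg mul1r.
have hhw w : h * (h * w) = w by rewrite mulrA hh mul1r.
have hgw w : h * (g * w) = g * (h * w) by rewrite mulrA hg mulrA.
have xgw w : x * (g * w) = h * (x * w) by rewrite mulrA xg mulrA.
have xhw w : x * (h * w) = g * (x * w) by rewrite mulrA xh mulrA.
exact: ((gg, ggw), (hh, hhw), (hg, hgw), (xg, xgw), (xh, xhw), xx).
Qed.

Lemma kp_free : free B. Proof. exact: basis_free (kp_basisP kpA). Qed.

Lemma kp_basis_ind (P : A -> Prop) :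
    (forall k u v, P u -> P v -> P (k *: u + v)) ->
    (forall i, (i < 8)%N -> P B`_i) -> forall u, P u.
Proof.
move=> PD PB u; have P0 : P 0.
  by rewrite -(subrr B`_0) addrC -scaleN1r; apply: PD; apply: PB.
rewrite (coord_basis (kp_basisP kpA) (memvf u)).
apply: big_ind => [//|v w Pv Pw|i _]; first by rewrite -[v]scale1r; apply: PD.
by rewrite -[_ *: _]addr0; apply: PD => //; apply: PB.
Qed.

Lemma kp_dual_ext (f f' : dual A) :
  (forall i, (i < 8)%N -> f B`_i = f' B`_i) -> f = f'.
Proof.
move=> ff'; apply/lfunP; apply: kp_basis_ind => // k u v fu fv.
by rewrite !linearP /= fu fv.
Qed.

Lemma kp_dualE i j : (i < 8)%N -> (j < 8)%N ->
  kp_dual g h x i B`_j = (i == j)%:R :> K.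
Proof.
move=> i8 j8; rewrite /kp_dual dvecE.
by rewrite -[j in B`_j](@inordK 7 j) // coord_free ?kp_free // -val_eqE /= !inordK // eq_sym.
Qed.

(** Multiplicativity of the coproduct extends its values on g, h, x to the whole basis; the
    arguments of [F] are in the normal form of [kp_mulE]. *)
Lemma kp_coprod_lift (V : vectType K) (F : A -> A -> V) : bilin F ->
  ((tens_lift F (coprod 1) = F 1 1)%R *
   (tens_lift F (coprod g) = F g g)%R *
   (tens_lift F (coprod h) = F h h)%R *
   (tens_lift F (coprod (g * h)) = F (g * h) (g * h))%R *
   (tens_lift F (coprod x) =
     2^-1 *: (F x x + F x (g * x) + F (h * x) x - F (h * x) (g * x)))%R *
   (tens_lift F (coprod (g * x)) =
     2^-1 *: (F (g * x) (g * x) + F (g * x) x + F (g * (h * x)) (g * x)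
              - F (g * (h * x)) x))%R *
   (tens_lift F (coprod (h * x)) =
     2^-1 *: (F (h * x) (h * x) + F (h * x) (g * (h * x)) + F x (h * x)
              - F x (g * (h * x))))%R *
   (tens_lift F (coprod (g * (h * x))) =
     2^-1 *: (F (g * (h * x)) (g * (h * x)) + F (g * (h * x)) (h * x)
              + F (g * x) (g * (h * x)) - F (g * x) (h * x)))%R)%type.
Proof.
move=> FB; have [[Dg Dh] Dx] := (kp_coprod_g kpA, kp_coprod_h kpA, kp_coprod_x kpA).
have lD S T : tens_lift F (S + T) = tens_lift F S + tens_lift F T by exact: linearD.
have lB S T : tens_lift F (S - T) = tens_lift F S - tens_lift F T by exact: linearB.
have lZ k T : tens_lift F (k *: T) = k *: tens_lift F T by exact: linearZ.
have D1 : coprod (1 : A) = 1 \ox 1 by rewrite rmorph1.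
have Dgx : coprod (g * x) = (g \ox g) * coprod x by rewrite rmorphM /= Dg.
have Dhx : coprod (h * x) = (h \ox h) * coprod x by rewrite rmorphM /= Dh.
have Dgh u : coprod (g * (h * u)) = (g \ox g) * ((h \ox h) * coprod u).
  by rewrite !rmorphM /= Dg Dh.
have Dghg : coprod (g * h) = (g * h) \ox (g * h) by rewrite rmorphM /= Dg Dh tensM.
do !split; rewrite ?D1 ?Dgh ?Dgx ?Dhx ?Dghg ?Dg ?Dh ?Dx -?scalerAr.
all: rewrite ?(mulrDr, mulrN, tensM) ?kp_mulE.
all: by rewrite ?lZ ?lB ?lD !tens_liftE.
Qed.

(* The product of A^* in coordinates with respect to the dual basis. *)
Definition kp_conv (c d : nat -> K) (i : nat) : K :=
  nth 0 [:: c 0%N * d 0%N; c 1%N * d 1%N; c 2%N * d 2%N; c 3%N * d 3%N;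
    2^-1 * (c 4%N * d 4%N + c 4%N * d 5%N + c 6%N * d 4%N - c 6%N * d 5%N);
    2^-1 * (c 5%N * d 5%N + c 5%N * d 4%N + c 7%N * d 5%N - c 7%N * d 4%N);
    2^-1 * (c 6%N * d 6%N + c 6%N * d 7%N + c 4%N * d 6%N - c 4%N * d 7%N);
    2^-1 * (c 7%N * d 7%N + c 7%N * d 6%N + c 5%N * d 7%N - c 5%N * d 6%N)] i.

(** Serves both for products in the dual and for lam(u1) lam(u2 v) with v fixed. *)
Lemma kp_coprod_conv (F : A -> A -> K^o) (c d : nat -> K) i : bilin F ->
    (forall j k, (j < 8)%N -> (k < 8)%N -> F B`_j B`_k = c j * d k) ->
    (i < 8)%N ->
  tens_lift F (coprod B`_i) = kp_conv c d i.
Proof.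
move=> FB Fcd i8; rewrite /kp_conv -!Fcd //= -!mulrA.
by case: i i8 => [|[|[|[|[|[|[|[|//]]]]]]]] _; rewrite /= -?mulrA (kp_coprod_lift FB).
Qed.

(* The Klein four-group of the indices 0, 1, 2, 3 of 1, g, h, gh. *)
Definition klein_mul (i j : nat) : nat :=
  nth 0%N (nth [::] [:: [:: 0; 1; 2; 3]; [:: 1; 0; 3; 2];
                       [:: 2; 3; 0; 1]; [:: 3; 2; 1; 0]]%N i) j.

(* x * B`_i = B`_(klein_swap i) * x for i < 4. *)
Definition klein_swap (i : nat) : nat := nth 0%N [:: 0; 2; 1; 3]%N i.

(* The value at B`_i * B`_j of the functional with value c k at B`_k. *)
Definition kp_mul_val (c : nat -> K) (i j : nat) : K :=
  if (i < 4)%N then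
    if (j < 4)%N then c (klein_mul i j) else c (4 + klein_mul i (j - 4))%N
  else if (j < 4)%N then c (4 + klein_mul (i - 4) (klein_swap j))%N
  else let m := klein_mul (i - 4) (klein_swap (j - 4)) in
    2^-1 * (c m + c (klein_mul m 1%N) + c (klein_mul m 2%N) - c (klein_mul m 3%N)).

(** Moving x to the right past a group-like swaps g and h; when x occurs twice, the four summands of
    x^2 give the four terms. *)
Lemma kp_mul_valE (f : {linear A -> K^o}) (c : nat -> K) i j :
    (forall k, (k < 8)%N -> f B`_k = c k) -> (i < 8)%N -> (j < 8)%N ->
  f (B`_i * B`_j) = kp_mul_val c i j.
Proof.
move=> fc i8 j8.
have [f0 f1 f2 f3] : [/\ f 1 = c 0%N, f g = c 1%N, f h = c 2%N & f (g * h) = c 3%N].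
  by split; rewrite -fc.
have [f4 f5 f6 f7] : [/\ f x = c 4%N, f (g * x) = c 5%N, f (h * x) = c 6%N
    & f (g * (h * x)) = c 7%N].
  by split; rewrite -fc // mulrA.
have fx u0 u1 u2 u3 : f (2^-1 *: (u0 + u1 + u2 - u3)) =
    2^-1 * (f u0 + f u1 + f u2 - f u3).
  by rewrite linearZ linearB !linearD.
by case: i i8 => [|[|[|[|[|[|[|[|//]]]]]]]] _;
  case: j j8 => [|[|[|[|[|[|[|[|//]]]]]]]] _; rewrite /kp_mul_val /=;
  rewrite -?mulrA ?mul1r ?mulr1 ?kp_mulE -?scalerAr
    ?(mulrDr g, mulrDr h, mulrN, mulr1) ?kp_mulE ?mulr1 ?fx ?(f0, f1, f2, f3, f4, f5, f6, f7).
Qed.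
End KacPaljutkinTheory.

(** * The pairing given by psi *)

Section Pairing.
Variables (K : fieldType) (A : hopfType K) (g h x : A).
Hypothesis kpA : kac_paljutkin g h x.
Variables (q r : K).

Local Notation B := (kp_basis g h x).
Local Notation psi := (kp_psi g h x q r).

(** Row i holds the coordinates of [psi B_i] in the dual basis, with [r] in the place of √2. *)
Definition kp_matrix : seq (seq K) :=
  [:: [:: 1;  1;  1;  1;  1;  1;  1;  1];
      [:: 1; -1; -1;  1; -q;  q;  q; -q];
      [:: 1; -1; -1;  1;  q; -q; -q;  q];
      [:: 1;  1;  1;  1; -1; -1; -1; -1];
      [:: 1; -q;  q; -1;  r;  0;  0; -r];
      [:: 1;  q; -q; -1;  0;  q * r; -(q * r); 0];
      [:: 1;  q; -q; -1;  0; -(q * r); q * r; 0];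
      [:: 1; -q;  q; -1; -r;  0;  0;  r]].

Lemma kp_psi_linear : linear psi.
Proof.
move=> k u v; rewrite /kp_psi scaler_sumr -big_split; apply: eq_bigr => i _.
by rewrite linearP scalerDl scalerA.
Qed.
HB.instance Definition _ :=
  GRing.isLinear.Build K A (dual A) _ psi kp_psi_linear.

Lemma kp_psi_nth i : (i < 8)%N -> psi B`_i = (kp_psi_basis g h x q r)`_i.
Proof.
move=> i8; rewrite /kp_psi (bigD1 (Ordinal i8)) //=.
have cE (j : 'I_8) : coord B j B`_i = (j == i :> nat)%:R.
  by have := kp_dualE kpA (ltn_ord j) i8; rewrite /kp_dual dvecE inord_val.
rewrite cE eqxx scale1r big1 ?addr0 // => j ji.
by rewrite cE (negPf (ji : j != i :> nat)) scale0r.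
Qed.

Lemma kp_pairing_nth i j : (i < 8)%N -> (j < 8)%N ->
  psi B`_i B`_j = (nth [::] kp_matrix i)`_j :> K.
Proof.
move=> i8 j8; rewrite kp_psi_nth //.
have E k (k8 : (k < 8)%N) := kp_dualE kpA k8 j8; move: B`_j E => v E.
have scaleE (a b : K) : a *: (b : K^o) = a * b by [].
case: i i8 => [|[|[|[|[|[|[|[|//]]]]]]]] _;
  rewrite /= !(add_lfunE, opp_lfunE, scale_lfunE) !E // ?scaleE {E};
  case: j j8 => [|[|[|[|[|[|[|[|//]]]]]]]] _;
  rewrite /= ?(mulr1, mulr0, subr0, addr0, add0r, sub0r, oppr0) //.
Qed.

Hypotheses (two_neq0 : (2 : K) != 0) (qq : q ^+ 2 = -1) (rr : r ^+ 2 = 2).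
Local Notation row m := (nth 0 (nth [::] kp_matrix m)).

(** The matrix is symmetric. This is what lets statements about products be transposed into
    statements about coproducts. *)
Lemma kp_psi_sym u v : psi u v = psi v u.
Proof.
have evL w : linear (fun u => psi u w).
  by move=> k a b; rewrite kp_psi_linear dualDE.
move: u v; apply: (kp_basis_ind kpA) => [k u u' Pu Pv w|i i8].
  by rewrite evL linearP /= Pu Pv.
apply: (kp_basis_ind kpA) => [k u v Pu Pv|j j8].
  by rewrite evL linearP /= Pu Pv.
rewrite !kp_pairing_nth //.
case: i i8 => [|[|[|[|[|[|[|[|//]]]]]]]] _;
  by case: j j8 => [|[|[|[|[|[|[|[|//]]]]]]]] _.
Qed.

Lemma kp_psi1 : psi 1 = 1.
Proof.
apply: (kp_dual_ext kpA) => i i8.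
rewrite (_ : psi 1 = psi B`_0) // kp_pairing_nth // dual1E.
rewrite (kp_counit kpA) ?mem_nth //.
by case: i i8 => [|[|[|[|[|[|[|[|//]]]]]]]].
Qed.

(** The indices 1, 2, 4 are those of g, h, x. By symmetry the left side is the value of psi(B_m B_n)
    at B_i, and the right side is that of psi(B_m) psi(B_n). *)
Lemma kp_matrix_mul m n i : m \in [:: 1; 2; 4]%N -> (n < 8)%N -> (i < 8)%N ->
  kp_mul_val (row i) m n = kp_conv (row m) (row n) i.
Proof.
rewrite !inE => /or3P[]/eqP->;
  case: n => [|[|[|[|[|[|[|[|//]]]]]]]] _;
  case: i => [|[|[|[|[|[|[|[|//]]]]]]]] _;
  rewrite /kp_mul_val /kp_conv /=; field: qq rr; by rewrite ?two_neq0.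
Qed.

Lemma kp_psi_generatorM m u : m \in [:: 1; 2; 4]%N ->
  psi (B`_m * u) = psi B`_m * psi u.
Proof.
move=> mB; have m8 : (m < 8)%N by move: mB; rewrite !inE => /or3P[]/eqP->.
move: u; apply: (kp_basis_ind kpA) => [k u v Pu Pv|n n8].
  by rewrite mulrDr -scalerAr !linearP /= Pu Pv mulrDr scalerAr.
apply: (kp_dual_ext kpA) => i i8.
rewrite (kp_psi_sym _ B`_i) (kp_mul_valE kpA (c := row i)) // => [|j j8]; last first.
  exact: kp_pairing_nth.
rewrite kp_matrix_mul // dualME; apply/esym/(kp_coprod_conv kpA) => //.
  exact: val_mul_bilin.
by move=> j k j8 k8; rewrite !kp_pairing_nth.
Qed.

(** The left factors for which multiplicativity holds form a subalgebra, and it contains the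
    generators g, h, x. *)
Lemma kp_psiM u v : psi (u * v) = psi u * psi v.
Proof.
pose P a := forall w, psi (a * w) = psi a * psi w.
have PM a b : P a -> P b -> P (a * b).
  by move=> Pa Pb w; rewrite -mulrA !Pa Pb mulrA.
suff : P u by apply.
move: u; apply: (kp_basis_ind kpA) => [k a b Pa Pb w|n n8].
  by rewrite mulrDl -scalerAl !linearP /= Pa Pb mulrDl scalerAl.
have P1 : P 1 by move=> w; rewrite kp_psi1 !mul1r.
have [Pg Ph Px] : [/\ P g, P h & P x].
  by split=> w; [apply: (@kp_psi_generatorM 1)|apply: (@kp_psi_generatorM 2)|
    apply: (@kp_psi_generatorM 4)].
by case: n n8 => [|[|[|[|[|[|[|[|//]]]]]]]] _ /=; auto.
Qed.
End Pairing.

(** * The map psi is an isomorphism of Hopf algebras *)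

Section PsiIsomorphism.
Variables (K : fieldType) (A : hopfType K) (g h x : A).
Hypothesis kpA : kac_paljutkin g h x.
Variables (q r : K).

Local Notation B := (kp_basis g h x).
Local Notation psi := (kp_psi g h x q r).
Hypotheses (two_neq0 : (2 : K) != 0) (qq : q ^+ 2 = -1) (rr : r ^+ 2 = 2).
Local Notation row m := (nth 0 (nth [::] (kp_matrix q r) m)).

(* Replacing q by -q plays the role of complex conjugation. *)
Lemma kp_matrix_orthogonal i k : (i < 8)%N -> (k < 8)%N ->
  \sum_(j < 8) nth 0 (nth [::] (kp_matrix (- q) r) k) j * row i j = 8 * (i == k)%:R.
Proof.
move=> i8 k8; rewrite !big_ord_recr big_ord0 /=.
by case: i i8 => [|[|[|[|[|[|[|[|//]]]]]]]] _;
  case: k k8 => [|[|[|[|[|[|[|[|//]]]]]]]] _; rewrite /=; ring: qq rr.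
Qed.

Lemma kp_matrix_sym q' i j : (i < 8)%N -> (j < 8)%N ->
  nth 0 (nth [::] (kp_matrix q' r) i) j = nth 0 (nth [::] (kp_matrix q' r) j) i.
Proof.
by case: i => [|[|[|[|[|[|[|[|//]]]]]]]] _;
  case: j => [|[|[|[|[|[|[|[|//]]]]]]]] _.
Qed.

Lemma kp_psi_bij : bijective psi.
Proof.
have eight : (8 : K) != 0.
  by rewrite (_ : 8 = 2 * 2 * 2) ?mulf_neq0 //; ring.
pose cj k j := nth 0 (nth [::] (kp_matrix (- q) r) k) j.
pose pr k (f : dual A) : K := \sum_(j < 8) cj k j * f B`_j.
(* The inverse matrix is one eighth of the conjugate matrix. *)
pose inv (f : dual A) : A := \sum_(k < 8) (8^-1 * pr k f) *: B`_k.
have invL : linear inv.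
  move=> k u v; rewrite /inv scaler_sumr -big_split; apply: eq_bigr => l _ /=.
  rewrite scalerA -scalerDl; congr (_ *: _).
  rewrite [k * _]mulrCA -mulrDr /pr [k * _]mulr_sumr -big_split; congr (_ * _).
  apply: eq_bigr => j _ /=; rewrite dualDE mulrDr; congr (_ + _).
  exact: mulrCA.
exists inv => [|f].
  apply: (kp_basis_ind kpA) => [k u v Pu Pv|i i8].
    by rewrite linearP invL Pu Pv.
  have sumE (k : 'I_8) : pr k (psi B`_i) = 8 * (i == k)%:R.
    by rewrite -kp_matrix_orthogonal // /pr; apply: eq_bigr => j _; rewrite kp_pairing_nth.
  rewrite /inv (bigD1 (Ordinal i8)) // big1 => [|k ki]; rewrite sumE.
    by rewrite eqxx mulr1 mulVf // scale1r [LHS]addr0.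
  by rewrite eq_sym (negPf (ki : k != i :> nat)) !mulr0 scale0r.
apply: (kp_dual_ext kpA) => i i8; rewrite /inv linear_sum sum_lfunE.
transitivity (\sum_(k < 8) 8^-1 * pr k f * row k i : K).
  by apply: eq_bigr => k _; rewrite linearZ scale_lfunE kp_pairing_nth.
under eq_bigr => k _ do rewrite -mulrA /pr mulr_suml.
rewrite -mulr_sumr exchange_big /=.
transitivity (8^-1 * \sum_(j < 8) f B`_j * (8 * (i == j)%:R) : K).
  congr (_ * _); apply: eq_bigr => j _; rewrite -kp_matrix_orthogonal // mulr_sumr.
  (* Symmetry of both matrices turns orthogonality of rows into that of columns. *)
  apply: eq_bigr => k _; rewrite /cj (kp_matrix_sym _ (ltn_ord k)) //.
  by rewrite [row k i](kp_matrix_sym _ (ltn_ord k)) // mulrAC mulrC.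
rewrite (bigD1 (Ordinal i8)) //= big1 ?addr0 => [|k ki].
  by rewrite eqxx mulr1 [_ * 8]mulrC mulrA mulVf // mul1r.
by rewrite eq_sym (negPf (ki : k != i :> nat)) !mulr0.
Qed.

(** For the coproduct: psi(u)(ab) = psi(ab)(u) = (psi(a) psi(b))(u), which is the sum of psi(u1)(a)
    psi(u2)(b). The counit is treated likewise, through psi(1) = ε. *)
Lemma kp_psi_hopf_iso : hopf_iso psi.
Proof.
have L := kp_psi_linear; have M : monoid_morphism psi by split; [exact: kp_psi1|exact: kp_psiM].
have D u : coprod (psi u) = tens_map psi psi (coprod u).
  apply: dual_eval_inj => a b.
  rewrite dual_coprodE [LHS](kp_psi_sym kpA) (kp_psiM kpA) // dualME [RHS]tens_lift_map.
  2: exact: dual_mul_bilin.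
  by apply: eq_tens_lift => v w; rewrite (kp_psi_sym kpA _ _ a) (kp_psi_sym kpA _ _ b).
have E u : counit (psi u) = counit u.
  by rewrite -[LHS]/(psi u 1) (kp_psi_sym kpA) (kp_psi1 kpA) dual1E.
split=> //; last exact: bialg_morphism_antipode.
by split=> //; apply: kp_psi_bij.
Qed.
End PsiIsomorphism.

(** * Partial actions *)

Section ActionEquations.
Variables (K : fieldType) (q : K).
Hypotheses (two_neq0 : (2 : K) != 0) (qq : q ^+ 2 = -1).

(* The values on kp_basis of the eight partial actions, in the order of the   *)
(* main theorem.                                                              *)
Definition kp_actions : seq (seq K) :=
  [:: [:: 1; 1; 1; 1; 1; 1; 1; 1];
      [:: 1; 0; 0; 1; (1 - q) / 2; (1 + q) / 2; (1 + q) / 2; (1 - q) / 2];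
      [:: 1; 0; 0; 1; (1 + q) / 2; (1 - q) / 2; (1 - q) / 2; (1 + q) / 2];
      [:: 1; 1; 1; 1; 0; 0; 0; 0];
      [:: 1; 0; 0; 1; 0; 0; 0; 0];
      [:: 1; 0; 1; 0; 0; 0; 0; 0];
      [:: 1; 1; 0; 0; 0; 0; 0; 0];
      [:: 1; 0; 0; 0; 0; 0; 0; 0]].

(** The equations lam(u) lam(v) = lam(u1) lam(u2 v) for basis elements u, v, where [l] lists the
    values of lam. *)
Definition kp_action_eqs (l : nat -> K) : Prop :=
  l 0%N = 1 /\ forall i j, (i < 8)%N -> (j < 8)%N ->
    l i * l j = kp_conv l (fun k => kp_mul_val l k j) i.

Lemma kp_actions_sound s : s \in kp_actions -> kp_action_eqs (nth 0 s).
Proof.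
(* Treats λ_q and λ_{-q} at once. *)
have z_sound z : z ^+ 2 = -1 -> kp_action_eqs (nth 0
    [:: 1; 0; 0; 1; (1 + z) / 2; (1 - z) / 2; (1 - z) / 2; (1 + z) / 2]).
  move=> zz; split=> // i j i8 j8.
  case: i i8 => [|[|[|[|[|[|[|[|//]]]]]]]] _;
    case: j j8 => [|[|[|[|[|[|[|[|//]]]]]]]] _; rewrite /kp_mul_val /kp_conv //=;
    field: zz; by rewrite ?two_neq0.
have one_sound : kp_action_eqs (nth 0 [:: 1; 1; 1; 1; 1; 1; 1; 1]).
  split=> // i j i8 j8.
  case: i i8 => [|[|[|[|[|[|[|[|//]]]]]]]] _;
    case: j j8 => [|[|[|[|[|[|[|[|//]]]]]]]] _; rewrite /kp_mul_val /kp_conv //=;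
    field; by rewrite ?two_neq0.
rewrite !inE => /or4P[/eqP->|/eqP->|/eqP->|]; first exact: one_sound.
- by have := z_sound (- q); rewrite sqrrN opprK; apply.
- exact: z_sound.
move=> sG; split=> [|i j i8 j8].
  by case/or4P: sG; [| | |case/orP]; move/eqP->.
case/or4P: sG; [| | |case/orP]; move/eqP->;
  case: i i8 => [|[|[|[|[|[|[|[|//]]]]]]]] _;
    rewrite /kp_conv /= ?mul0r ?addr0 ?subr0 ?mulr0 //;
  case: j j8 => [|[|[|[|[|[|[|[|//]]]]]]]] _;
    rewrite /kp_mul_val /= ?mulr0 ?mulr1 ?subrr ?addr0 ?subr0 ?mulr0 //.
Qed.
(** Derives an equation from a combination of known ones, leaving an identity to [ring]. *)
Lemma eq_comb (y z u v : K) : u = v -> y - z = u - v -> y = z.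
Proof. by move=> ->; rewrite subrr => /subr0_eq. Qed.

Lemma idem_field (y : K) : y = y * y -> y = 0 \/ y = 1.
Proof.
move=> yy; have /eqP : y * (y - 1) = 0 by rewrite mulrBr mulr1 -yy subrr.
by rewrite mulf_eq0 subr_eq0 => /orP[]/eqP; [left|right].
Qed.

Lemma sqr_eq0 (y : K) : 2 * (y * y) = 0 -> y = 0.
Proof. by move/eqP; rewrite !mulf_eq0 (negPf two_neq0) orbb => /eqP. Qed.

Lemma mul2_eq0 (y : K) : 2 * y = 0 -> y = 0.
Proof. by move/eqP; rewrite mulf_eq0 (negPf two_neq0) => /eqP. Qed.

Lemma kp_actions_complete (l : nat -> K) :
  kp_action_eqs l -> mkseq l 8 \in kp_actions.
Proof.
case=> l0 E; rewrite /mkseq /= l0.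
(* Group-like u: lam(u) is idempotent, and where it is 1, lam is invariant under translation by
   u. *)
have G i j : (0 < i < 4)%N -> (j < 8)%N -> l i * l j = l i * kp_mul_val l i j.
  by case: i => [|[|[|[|//]]]] // _ j8; rewrite E.
(* u in {x, gx, hx, ghx} and v group-like, with denominators cleared. *)
have X (i j : nat) : (i < 4)%N -> (j < 4)%N ->
    let d := l (4 + klein_mul i (klein_swap j))%N in
    let d' := l (4 + klein_mul (klein_mul i 1) (klein_swap j))%N in
    2 * (l (4 + i)%N * l j) = l (4 + i)%N * d + l (4 + i)%N * d'
      + l (4 + klein_mul i 2)%N * d - l (4 + klein_mul i 2)%N * d'.
  move=> i4 j4 /=; rewrite E ?(ltn_trans j4) //.
  by case: i i4 => [|[|[|[|//]]]] _; case: j j4 => [|[|[|[|//]]]] _;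
    rewrite /kp_conv /= mulVKf.
have [a_idem b_idem] := (G 1 0 isT isT, G 2 0 isT isT)%N.
have c_idem := G 3 0 isT isT.
have [[ab ap] at_] := (G 1 2 isT isT, G 1 4 isT isT, G 1 6 isT isT)%N.
have [[bp bs] ca] := (G 2 4 isT isT, G 2 5 isT isT, G 3 1 isT isT)%N.
have [cp cs] := (G 3 4 isT isT, G 3 5 isT isT)%N.
have [[p1 pa] [pb pc]] := ((X 0 0 isT isT, X 0 1 isT isT), (X 0 2 isT isT, X 0 3 isT isT))%N.
have [[s1 sa] [sb sc]] := ((X 1 0 isT isT, X 1 1 isT isT), (X 1 2 isT isT, X 1 3 isT isT))%N.
have [[ta tb] tc] := (X 2 1 isT isT, X 2 2 isT isT, X 2 3 isT isT)%N.
move: a_idem b_idem c_idem ab ap at_ bp bs ca cp cs p1 pa pb pc s1 sa sb sc ta tb tc.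
rewrite /kp_mul_val /= l0 !mulr1 {G X E}.
(* The values at g, h, gh are a, b, c; those at x, gx, hx, ghx are p, s, t, w. *)
move: (l 1) (l 2) (l 3) (l 4) (l 5) (l 6) (l 7) => {l l0} a b c p s t w.
move=> a_idem b_idem c_idem ab ap at_ bp bs ca cp cs.
move=> p1 pa pb pc s1 sa sb sc ta tb tc.
case: (idem_field a_idem) => a01; subst a.
  case: (idem_field c_idem) => c01; subst c; last first.
    (* N = {1, gh}: invariance leaves p and s, with p^2 + s^2 = 0 and p (p + s - 1) = 0. *)
    rewrite !mul1r in ca cp cs; subst b w t => {a_idem b_idem c_idem ab ap at_ bp bs}.
    have ps2 : 2 * (p * p + s * s) = 0 by apply: (eq_comb (congr1 ( *%R (-2)) pa)); ring.
    have /eqP : 2 * (p * (p + s - 1)) = 0.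
      by apply: (eq_comb (esym (congr2 +%R p1 pa))); ring.
    rewrite !mulf_eq0 (negPf two_neq0) orFb => /orP[/eqP p0|/eqP ps1].
      have s0 : s = 0 by apply: sqr_eq0; rewrite -ps2 p0 mul0r add0r.
      by rewrite p0 s0 !inE eqxx ?orbT.
    have sE : s = 1 - p by apply: (eq_comb ps1); ring.
    (* Substituting s = 1 - p gives a quadratic with roots (1 ± q)/2, the source of λ_q and
       λ_{-q}. *)
    have /eqP : (2 * p - (1 + q)) * (2 * p - (1 - q)) = 0.
      by rewrite -ps2 sE; ring: qq.
    rewrite mulf_eq0 !subr_eq0 => /orP[]/eqP p2.
      have pE : p = (1 + q) / 2 by rewrite -p2 mulrC mulKf.
      have -> : s = (1 - q) / 2 by rewrite sE pE; field.
      rewrite pE.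
      by rewrite !inE eqxx ?orbT.
    have pE : p = (1 - q) / 2 by rewrite -p2 mulrC mulKf.
    have -> : s = (1 + q) / 2 by rewrite sE pE; field.
    rewrite pE.
    by rewrite !inE eqxx ?orbT.
  case: (idem_field b_idem) => b01; subst b; last first.
    (* N = {1, h}. *)
    rewrite !mul1r in bp bs; subst p s.
    have -> : t = 0 by apply: sqr_eq0; apply: (eq_comb (esym pa)); ring.
    have -> : w = 0 by apply: sqr_eq0; apply: (eq_comb (esym sa)); ring.
    by rewrite !inE eqxx ?orbT.
  (* N = {1}: sums and differences of the equations give quadratic relations that force p^3 = 0,
     after which the other values vanish too. *)
  have ptw : p * t + p * w = 0.
    by apply: mul2_eq0; apply: (eq_comb (esym (congr2 +%R pa pc))); ring.
  have ttw : t * t - t * w = 0.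
    by apply: mul2_eq0; apply: (eq_comb (esym (congr2 (fun y z => y - z) pa pc))); ring.
  have tsp : t * s + t * p = 0.
    by apply: mul2_eq0; apply: (eq_comb (esym (congr2 +%R ta tc))); ring.
  have pps : p * p - p * s = 0.
    by apply: mul2_eq0; apply: (eq_comb (esym (congr2 (fun y z => y - z) ta tc))); ring.
  have ttp : t * t - p * t = 0.
    apply: mul2_eq0; transitivity ((t * w + t * t + p * w - p * t)
      + (t * t - t * w) - (p * t + p * w)); first by ring.
    by rewrite -tb ttw ptw !mulr0 addr0 subr0.
  have ppt : p * p - p * t = 0.
    apply: mul2_eq0; transitivity ((p * s + p * p + t * s - t * p)
      + (p * p - p * s) - (t * s + t * p)); first by ring.
    by rewrite -pb pps tsp !mulr0 addr0 subr0.
  have p0 : p = 0.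
    have /eqP : 2 * (p * (p * p)) = 0.
      transitivity (2 * p * (p * p - p * t) + p * (t * s + t * p) + t * (p * p - p * s)).
        by ring.
      by rewrite ppt tsp pps !mulr0 !addr0.
    by rewrite !mulf_eq0 (negPf two_neq0) !orbb => /eqP.
  have t0 : t = 0 by apply: sqr_eq0; move: ttp; rewrite p0 mul0r subr0 => ->; rewrite mulr0.
  subst p t.
  have w0 : w = 0.
    by apply: sqr_eq0; apply: (eq_comb (esym (congr2 (fun y z => y - z) sa sc))); ring.
  subst w; have -> : s = 0 by apply: sqr_eq0; apply: (eq_comb (congr1 ( *%R (- 2)) sb)); ring.
  by rewrite !inE eqxx ?orbT.
rewrite !mul1r in ab ap at_; subst c s w.
case: (idem_field b_idem) => b01; subst b.
  (* N = {1, g}. *)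
  have -> : p = 0 by apply: sqr_eq0; apply: (eq_comb (congr1 -%R pb)); ring.
  have -> : t = 0 by apply: sqr_eq0; apply: (eq_comb (congr1 -%R tb)); ring.
  by rewrite !inE eqxx ?orbT.
(* N is the whole group: the four remaining values coincide in one idempotent scalar. *)
rewrite !mul1r in bp; subst t.
have /idem_field[] : p = p * p.
  by apply: (mulfI two_neq0); apply: (eq_comb p1); ring.
- by move=> ->; rewrite !inE eqxx ?orbT.
by move=> ->; rewrite !inE eqxx ?orbT.
Qed.
End ActionEquations.

(** * The eight solutions and their preimages under psi *)

Section Classification.
Variables (K : fieldType) (A : hopfType K) (g h x : A).
Hypothesis kpA : kac_paljutkin g h x.
Variables (q r : K).
Hypotheses (two_neq0 : (2 : K) != 0) (qq : q ^+ 2 = -1) (rr : r ^+ 2 = 2).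

Local Notation B := (kp_basis g h x).
Local Notation psi := (kp_psi g h x q r).
Local Notation row m := (nth 0 (nth [::] (kp_matrix q r) m)).

Lemma kp_partial_action_eqs (lam : dual A) (l : nat -> K) :
  (forall i, (i < 8)%N -> lam B`_i = l i) ->
  partial_action lam <-> kp_action_eqs l.
Proof.
move=> lamE.
have FB v : bilin (fun a b => lam a * lam (b * v) : K^o).
  split=> [b k a a'|a k b b'] /=; first by rewrite linearP mulrDl scalerAl.
  by rewrite mulrDl -scalerAl linearP mulrDr scalerAr.
have E i j : (i < 8)%N -> (j < 8)%N ->
    tens_lift (fun a b => lam a * lam (b * B`_j) : K^o) (coprod B`_i) =
    kp_conv l (fun k => kp_mul_val l k j) i.
  move=> i8 j8; apply: (kp_coprod_conv kpA) => // a b a8 b8.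
  by rewrite lamE // (kp_mul_valE kpA (c := l)).
split=> [[lam1 lamM]|[l0 lM]].
  split=> [|i j i8 j8]; first by rewrite -lamE.
  by rewrite -!lamE // lamM E.
split=> [|u v]; first by rewrite -[1]/(B`_0) lamE.
move: u v; apply: (kp_basis_ind kpA) => [k u u' Pu Pu' v|i i8].
  rewrite (linearP lam) mulrDl -scalerAl Pu Pu'.
  by rewrite (linearP coprod) tens_lift_linear.
apply: (kp_basis_ind kpA) => [k v v' Pv Pv'|j j8]; last by rewrite E // -lM // !lamE.
rewrite linearP mulrDr -scalerAr Pv Pv' -tens_lift_fun; apply: eq_tens_lift => a b.
by rewrite mulrDr -scalerAr linearP mulrDr scalerAr.
Qed.

Definition kp_values (f : dual A) : seq K := mkseq (fun i => f B`_i) 8.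

Lemma kp_values_inj : injective kp_values.
Proof.
move=> f f' ff'; apply: (kp_dual_ext kpA) => i i8.
by rewrite -(nth_mkseq 0 (fun i => f B`_i : K) i8) -/(kp_values f) ff' nth_mkseq.
Qed.

Lemma kp_partial_actionP (lam : dual A) :
  partial_action lam <-> kp_values lam \in kp_actions q.
Proof.
split=> [|lamB].
  by move/(kp_partial_action_eqs (l := fun i => lam B`_i)) => lamE;
    apply: kp_actions_complete => //; apply: lamE.
apply/(kp_partial_action_eqs (l := nth 0 (kp_values lam))) => [i i8|].
  by rewrite /kp_values nth_mkseq.
exact: (kp_actions_sound two_neq0 qq).
Qed.

Definition kp_elts : seq A :=
  let s := ((1 - q) / 2) *: x + ((1 + q) / 2) *: (g * x) in
  let s' := ((1 + q) / 2) *: x + ((1 - q) / 2) *: (g * x) in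
  [:: 1; 2^-1 *: (1 + g); 2^-1 *: (1 + h); 2^-1 *: (1 + g * h);
      4^-1 *: (1 + g + h + g * h); 4^-1 *: (1 + g * h + s + g * h * s);
      4^-1 *: (1 + g * h + s' + g * h * s');
      8^-1 *: (1 + g + h + g * h + x + g * x + h * x + g * h * x)].

(** Multiplication by gh takes x to ghx and gx to hx; [y q] belongs to s and [y (- q)] to its
    conjugate. *)
Lemma kp_elts_values (f : {linear A -> K^o}) (c : nat -> K) :
    (forall k, (k < 8)%N -> f B`_k = c k) ->
  map f kp_elts =
    let y (z : K) := 4^-1 * (c 0%N + c 3%N + ((1 - z) / 2 * c 4%N + (1 + z) / 2 * c 5%N)
      + ((1 - z) / 2 * c 7%N + (1 + z) / 2 * c 6%N)) in
    [:: c 0%N; 2^-1 * (c 0%N + c 1%N); 2^-1 * (c 0%N + c 2%N); 2^-1 * (c 0%N + c 3%N);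
      4^-1 * (c 0%N + c 1%N + c 2%N + c 3%N); y q; y (- q);
      8^-1 * (c 0%N + c 1%N + c 2%N + c 3%N + c 4%N + c 5%N + c 6%N + c 7%N)].
Proof.
move=> fc; have fD u v : f (u + v) = f u + f v by exact: linearD.
have fZ k u : f (k *: u) = (k : K) * f u by exact: linearZ.
have ghs k l : g * h * (k *: x + l *: (g * x)) = k *: (g * h * x) + l *: (h * x).
  by rewrite mulrDr -!scalerAr -!mulrA !(kp_mulE kpA).
by rewrite -!fc //= opprK !ghs !(fD, fZ).
Qed.

(** By symmetry psi(e)(B_i) = psi(B_i)(e), so that each row of the matrix is applied to the explicit
    elements. *)
Lemma kp_psi_elts_values : map (kp_values \o psi) kp_elts = kp_actions q.
Proof.
have four_neq0 : (4 : K) != 0 by rewrite (natrM _ 2 2) mulf_neq0.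
have eight_neq0 : (8 : K) != 0 by rewrite (natrM _ 2 4) mulf_neq0.
have E i n : (i < 8)%N -> (n < 8)%N -> psi kp_elts`_n B`_i = (nth [::] (kp_actions q) n)`_i.
  move=> i8 n8; rewrite (kp_psi_sym kpA) -(nth_map _ 0) //.
  rewrite (@kp_elts_values _ (row i)) => [|k k8]; last exact: (kp_pairing_nth kpA).
  case: i i8 => [|[|[|[|[|[|[|[|//]]]]]]]] _;
    case: n n8 => [|[|[|[|[|[|[|[|//]]]]]]]] _ //=;
    field: qq rr; by rewrite ?two_neq0 ?four_neq0 ?eight_neq0.
have -> : kp_actions q = mkseq (nth [::] (kp_actions q)) 8 by [].
apply: (@eq_from_nth _ [::]) => // n n8.
rewrite nth_mkseq // (nth_map 0) //=; apply: (@eq_from_nth _ 0) => [|i].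
  by case: n n8 => [|[|[|[|[|[|[|[|//]]]]]]]].
by rewrite size_mkseq => i8; rewrite nth_mkseq // E.
Qed.

Lemma kp_psi_elts_nth n i : (n < 8)%N -> (i < 8)%N ->
  psi kp_elts`_n B`_i = (nth [::] (kp_actions q) n)`_i :> K.
Proof.
move=> n8 i8; rewrite -kp_psi_elts_values (nth_map 0) //=.
by rewrite -[LHS](nth_mkseq 0 (fun i => psi kp_elts`_n B`_i : K) i8).
Qed.

Lemma kp_lambda_nth z i : (i < 8)%N -> kp_lambda g h x z B`_i =
  [:: 1; 0; 0; 1; (1 + z) / 2; (1 - z) / 2; (1 - z) / 2; (1 + z) / 2]`_i :> K.
Proof.
move=> i8; have E k (k8 : (k < 8)%N) := kp_dualE kpA k8 i8; move: B`_i E => v E.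
have scaleE (a b : K) : a *: (b : K^o) = a * b by [].
rewrite /kp_lambda !(add_lfunE, scale_lfunE) !E // !scaleE {E}.
by case: i i8 => [|[|[|[|[|[|[|[|//]]]]]]]] _;
  rewrite /= ?(mulr1, mulr0, addr0, add0r).
Qed.

Lemma kp_lambda0_nth N i : all (fun k => k < 8)%N N -> (i < 8)%N ->
  kp_lambda0 g h x [seq B`_k | k <- N] B`_i = (i \in N)%:R :> K.
Proof.
move=> /allP N8 i8; rewrite /kp_lambda0 sum_lfunE.
have memB k : (k < 8)%N -> (B`_k \in [seq B`_j | j <- N]) = (k \in N).
  move=> k8; apply/mapP/idP => [[j jN /eqP]|kN]; last by exists k.
  have uB : uniq B by apply: free_uniq; apply: kp_free kpA.
  by rewrite nth_uniq ?size_tuple ?(N8 _ jN) // => /eqP->.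
have E (k : 'I_8) :
    ((B`_k \in [seq B`_j | j <- N])%:R *: dvec B k) B`_i =
    ((nat_of_ord k \in N)%:R * (k == i :> nat)%:R : K).
  rewrite scale_lfunE memB //; congr (_ * _).
  by have := kp_dualE kpA (ltn_ord k) i8; rewrite /kp_dual inord_val.
under eq_bigr => k _ do rewrite E.
rewrite (bigD1 (Ordinal i8)) // big1 => [|k ki].
  by rewrite [LHS]addr0 eqxx mulr1.
by rewrite (negPf (ki : k != i :> nat)) mulr0.
Qed.

Lemma kp_partial_action_psi (lam : dual A) :
  partial_action lam <-> lam \in map psi kp_elts.
Proof.
by rewrite -(mem_map kp_values_inj) -map_comp kp_psi_elts_values;
  apply: kp_partial_actionP.
Qed.

(** [psi] transports the condition on e to the dual, where the solutions are known; injectivity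
    brings the list back. *)
Lemma kp_coaction_elts (e : A) : coaction_elt e <-> e \in kp_elts.
Proof.
rewrite -(hopf_iso_coaction_elt e (kp_psi_hopf_iso kpA two_neq0 qq rr)).
rewrite -partial_actionP kp_partial_action_psi mem_map //.
exact: bij_inj (kp_psi_bij kpA two_neq0 qq rr).
Qed.

Lemma kp_actions_uniq : uniq (kp_actions q).
Proof.
have q0 : q != 0.
  by apply/eqP => q0; move/eqP: qq; rewrite q0 expr0n /= eq_sym oppr_eq0 oner_eq0.
have pm : (1 + q) / 2 != (1 - q) / 2.
  rewrite (inj_eq (mulIf _)) ?invr_neq0 // (inj_eq (addrI _)) -subr_eq0 opprK.
  by rewrite -mulr2n -mulr_natl mulf_neq0.
have half (z : K) : z ^+ 2 = -1 -> (1 + z) / 2 != 0.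
  move=> zz; rewrite mulf_neq0 ?invr_neq0 // addrC addr_eq0; apply/eqP=> zE.
  move/eqP: zz; rewrite zE sqrrN expr1n -subr_eq0 opprK -mulr2n.
  by rewrite (negPf two_neq0).
have mq : (1 - q) / 2 != 0 by apply: half; rewrite sqrrN.
have m01 : (0 == 1 :> K) = false by rewrite eq_sym oner_eq0.
rewrite /kp_actions /= !inE !eqseq_cons !eqxx !(oner_eq0, m01) /=.
by rewrite (negPf (half _ qq)) (negPf mq) (negPf pm) eq_sym (negPf pm).
Qed.

Lemma kp_elts_uniq : uniq kp_elts.
Proof.
by apply: (@map_uniq _ _ (kp_values \o psi)); rewrite kp_psi_elts_values kp_actions_uniq.
Qed.
End Classification.

Theorem mainTheorem3 (K : closedFieldType) (charK0 : [pchar K] =i pred0)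
    (xi : K) (xi_prim : 8.-primitive_root xi)
    (A : hopfType K) (g h x : A) (kpA : kac_paljutkin g h x) :
  let q := xi ^+ 2 in
  let sqrt2 := 2 * xi / (1 + xi ^+ 2) in
  let s := ((1 - q) / 2) *: x + ((1 + q) / 2) *: (g * x) in
  let s' := ((1 + q) / 2) *: x + ((1 - q) / 2) *: (g * x) in
  let psi := kp_psi g h x q sqrt2 in
  let e1 : A := 1 in
  let e2 := 2^-1 *: (1 + g) in
  let e3 := 2^-1 *: (1 + h) in
  let e4 := 2^-1 *: (1 + g * h) in
  let e5 := 4^-1 *: (1 + g + h + g * h) in
  let e6 := 4^-1 *: (1 + g * h + s + g * h * s) in
  let e7 := 4^-1 *: (1 + g * h + s' + g * h * s') in
  let e8 := 8^-1 *: (1 + g + h + g * h + x + g * x + h * x + g * h * x) in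
  let es := [:: e1; e2; e3; e4; e5; e6; e7; e8] in
  [/\ hopf_iso psi,
      uniq es,
      forall rho : {linear K^o -> tens K^o A},
        partial_coaction rho <-> (exists2 e, e \in es & rho 1 = 1 \ox e),
      forall lam : dual A, partial_action lam <-> lam \in map psi es
    & [/\ psi e1 =1 counit,
          psi e2 = kp_lambda g h x (- q),
          psi e3 = kp_lambda g h x q
        & psi e4 = kp_lambda0 g h x [:: 1; g; h; g * h]] /\
      [/\ psi e5 = kp_lambda0 g h x [:: 1; g * h],
          psi e6 = kp_lambda0 g h x [:: 1; h],
          psi e7 = kp_lambda0 g h x [:: 1; g]
        & psi e8 = kp_lambda0 g h x [:: 1]]].

Proof.
have two_neq0 : (2 : K) != 0 by have /pcharf0P-> := charK0.
(* xi^4 is a square root of 1, and it is not 1 because xi has order 8. *)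
have xi4 : xi ^+ 4 = -1.
  have /eqP : (xi ^+ 4 - 1) * (xi ^+ 4 + 1) = 0.
    by rewrite -subr_sqr -exprM (prim_expr_order xi_prim) expr1n subrr.
  by rewrite mulf_eq0 subr_eq0 -(prim_order_dvd xi_prim) /= addr_eq0 => /eqP.
move=> q sqrt2 s s' psi e1 e2 e3 e4 e5 e6 e7 e8 es.
have qq : q ^+ 2 = -1 by rewrite -exprM.
have rr : sqrt2 ^+ 2 = 2.
  (* Hence the square of 2 xi / (1 + q) is 4q / 2q = 2. *)
  have d2 : (1 + q) ^+ 2 = 2 * q by rewrite sqrrD qq; ring.
  have q0 : q != 0.
    by apply/eqP => q0; move/eqP: qq; rewrite q0 expr0n /= eq_sym oppr_eq0 oner_eq0.
  rewrite /sqrt2 expr_div_n d2 exprMn -/q; field.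
  by rewrite q0 two_neq0.
have valE n (lam : dual A) : (n < 8)%N ->
    (forall i, (i < 8)%N -> lam (kp_basis g h x)`_i =
      (nth [::] (kp_actions q) n)`_i :> K) -> psi es`_n = lam.
  move=> n8 lamE; apply: (kp_dual_ext kpA) => i i8.
  by rewrite (kp_psi_elts_nth kpA two_neq0 qq rr n8 i8) lamE.
split.
- exact: kp_psi_hopf_iso.
- exact: (kp_elts_uniq kpA two_neq0 qq rr).
- move=> rho; rewrite partial_coaction_scalarP.
  by split=> -[e ee]; exists e => //; apply/(kp_coaction_elts kpA two_neq0 qq rr).
- exact: (kp_partial_action_psi kpA two_neq0 qq rr).
split.
  split.
  - by move=> u; rewrite /psi /e1 (kp_psi1 kpA) dual1E.
  - apply: (valE 1%N) => // i i8; rewrite kp_lambda_nth // opprK.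
    by [].
  - by apply: (valE 2%N) => // i i8; rewrite kp_lambda_nth.
  - apply: (valE 3%N) => // i i8; rewrite (kp_lambda0_nth kpA (N := iota 0 4)) //.
    by case: i i8 => [|[|[|[|[|[|[|[|//]]]]]]]].
split.
- apply: (valE 4%N) => // i i8; rewrite (kp_lambda0_nth kpA (N := [:: 0; 3]%N)) //.
  by case: i i8 => [|[|[|[|[|[|[|[|//]]]]]]]].
- apply: (valE 5%N) => // i i8; rewrite (kp_lambda0_nth kpA (N := [:: 0; 2]%N)) //.
  by case: i i8 => [|[|[|[|[|[|[|[|//]]]]]]]].
- apply: (valE 6%N) => // i i8; rewrite (kp_lambda0_nth kpA (N := [:: 0; 1]%N)) //.
  by case: i i8 => [|[|[|[|[|[|[|[|//]]]]]]]].
- apply: (valE 7%N) => // i i8; rewrite (kp_lambda0_nth kpA (N := [:: 0]%N)) //.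
  by case: i i8 => [|[|[|[|[|[|[|[|//]]]]]]]].
Qed.
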